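(* Let $(M,\{\eta_1,\dots,\eta_k\},\{\omega_1,\dots,\omega_k\})$ be a $k$-pre-cosymplectic manifold. There exist a $k$-cosymplectic manifold $(\widetilde M,\{\widetilde\eta_i\},\{\widetilde\omega_j\})$ and an embedding $\mathfrak i\colon M\hookrightarrow\widetilde M$ with $\mathfrak i^*\widetilde\eta_i=\eta_i$ and $\mathfrak i^*\widetilde\omega_j=\omega_j$ for all $i,j\in\{1,\dots,k\}$ such that $\mathfrak i(M)$ is a $k$-coisotropic submanifold of $\widetilde M$.
   Context: All manifolds, forms and maps are smooth. A $k$-pre-cosymplectic manifold is a tuple $(M,\{\eta_1,\dots,\eta_k\},\{\omega_1,\dots,\omega_k\})$ with $M$ a finite-dimensional manifold, $\eta_i$ closed 1-forms and $\omega_j$ closed 2-forms. Its characteristic distribution is $\mathcal V=\big(\bigcap_{i=1}^k\ker\eta_i\big)\cap\big(\bigcap_{j=1}^k\ker\omega_j\big)$. Standing assumptions on such a manifold $M$: all the forms have constant rank, the $\eta_i$ are nowhere zero, and $\mathcal V$ is a smooth distribution of constant rank. A $k$-cosymplectic manifold is a tuple $(\widetilde M,\{\widetilde\eta_1,\dots,\widetilde\eta_k\},\{\widetilde\omega_1,\dots,\widetilde\omega_k\})$ with $\widetilde M$ a finite-dimensional manifold, $\widetilde\eta_i$ closed 1-forms and $\widetilde\omega_j$ closed 2-forms on $\widetilde M$, whose characteristic distribution $\big(\bigcap_{i=1}^k\ker\widetilde\eta_i\big)\cap\big(\bigcap_{j=1}^k\ker\widetilde\omega_j\big)$ is $\{0\}$.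 A submanifold $N$ of a $k$-cosymplectic manifold $(\widetilde M,\{\widetilde\eta_i\},\{\widetilde\omega_j\})$ is $\ell$-coisotropic ($1\le\ell\le k$) if for every $n\in N$ the subspace $\{X\in T_n\widetilde M:\widetilde\eta_i(X)=0,\ \widetilde\omega_j(X,Y)=0\ \forall i,j\in\{1,\dots,\ell\},\ \forall Y\in T_nN\}$ is contained in $T_nN$. *)

(* Defs.v *)
(* MathComp-Analysis.  Smooth manifolds are given by atlases and all tensors   *)
(* by their local expressions: a tangent vector at p is represented, in each   *)
(* chart c around p, by its row of components v : 'rV_n, and its components in *)
(* another chart d are 'd (transition c d) (c p) v.                            *)
From HB Require Import structures.
From mathcomp Require Import all_boot all_order all_algebra.
From mathcomp Require Import all_classical all_reals all_analysis.
Import Order.TTheory GRing.Theory Num.Theory.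
Import numFieldNormedType.Exports.

Set Implicit Arguments.
Unset Strict Implicit.
Unset Printing Implicit Defensive.

Local Open Scope classical_set_scope.
Local Open Scope ring_scope.

(* Only meaningful for U open. *)
Fixpoint Cn (R : realType) (V W : normedModType R) (r : nat) (U : set V)
    (f : V -> W) : Prop :=
  match r with
  | 0 => forall x, U x -> {for x, continuous f}
  | r'.+1 => (forall x, U x -> differentiable f x) /\
             (forall v : V, Cn r' U (fun x => 'D_v f x))
  end.

Definition smooth_on (R : realType) (V W : normedModType R) (U : set V)
    (f : V -> W) : Prop :=
  forall r, Cn r U f.

(* The values of the chart outside [chart_dom], and of its inverse outside the *)
(* image of [chart_dom], are irrelevant.                                       *)
Record chart (R : realType) (M : topologicalType) (n : nat) := Chart {
  chart_dom : set M;
  chart_map :> M -> 'rV[R]_n;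
  chart_inv : 'rV[R]_n -> M;
  chart_dom_open : open chart_dom;
  chart_im_open : open (chart_map @` chart_dom);
  chart_mapK : forall p, chart_dom p -> chart_inv (chart_map p) = p;
  chart_map_continuous : forall p, chart_dom p -> {for p, continuous chart_map};
  chart_inv_continuous :
    forall x, (chart_map @` chart_dom) x -> {for x, continuous chart_inv} }.

Definition chart_im (R : realType) (M : topologicalType) (n : nat)
    (c : chart R M n) : set 'rV[R]_n :=
  c @` chart_dom c.

Definition local_expr (R : realType) (M N : topologicalType) (m n : nat)
    (f : M -> N) (c : chart R M m) (d : chart R N n) : 'rV[R]_m -> 'rV[R]_n :=
  fun x => d (f (chart_inv c x)).

Definition transition (R : realType) (M : topologicalType) (m n : nat)
    (c : chart R M m) (d : chart R M n) : 'rV[R]_m -> 'rV[R]_n :=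
  local_expr id c d.

Definition compatible (R : realType) (M : topologicalType) (n : nat)
    (c d : chart R M n) : Prop :=
  smooth_on (c @` (chart_dom c `&` chart_dom d)) (transition c d) /\
  smooth_on (d @` (chart_dom c `&` chart_dom d)) (transition d c).

(* The atlas need not be maximal. *)
Record manifold (R : realType) (n : nat) := Manifold {
  carrier :> topologicalType;
  atlas_index : Type;
  atlas : atlas_index -> chart R carrier n;
  manifold_hausdorff : hausdorff_space carrier;
  manifold_second_countable : @second_countable carrier;
  atlas_cover : forall p : carrier, exists a, chart_dom (atlas a) p;
  atlas_compatible : forall a b, compatible (atlas a) (atlas b) }.

Definition smooth_map (R : realType) (m n : nat) (M : manifold R m)
    (N : manifold R n) (f : M -> N) : Prop :=
  continuous f /\
  forall (a : atlas_index M) (b : atlas_index N),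
    smooth_on (atlas a @` (chart_dom (atlas a) `&` f @^-1` chart_dom (atlas b)))
              (local_expr f (atlas a) (atlas b)).

Definition immersion (R : realType) (m n : nat) (M : manifold R m)
    (N : manifold R n) (f : M -> N) : Prop :=
  smooth_map f /\
  forall (p : M) (a : atlas_index M) (b : atlas_index N),
    chart_dom (atlas a) p -> chart_dom (atlas b) (f p) ->
    injective ('d (local_expr f (atlas a) (atlas b)) (atlas a p)
                 : 'rV[R]_m -> 'rV[R]_n).

(* The last clause says that f is open onto its image. *)
Definition embedding (R : realType) (m n : nat) (M : manifold R m)
    (N : manifold R n) (f : M -> N) : Prop :=
  [/\ immersion f, injective f &
      forall U : set M, open U ->
        exists2 V : set N, open V & f @` U = V `&` range f].

Definition ev1 (R : realType) (n : nat) (l : 'cV[R]_n) (v : 'rV[R]_n) : R :=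
  (v *m l) 0 0.

Definition ev2 (R : realType) (n : nat) (B : 'M[R]_n) (v w : 'rV[R]_n) : R :=
  (v *m B *m w^T) 0 0.

(* [form1_loc a x] (resp. [form2_loc a x]) is the column (resp. skew matrix)   *)
(* of components of the form, in the chart [atlas a], at the point with        *)
(* coordinates x; only its values on [chart_im (atlas a)] matter.              *)
Record form1 (R : realType) (n : nat) (M : manifold R n) := Form1 {
  form1_loc :> atlas_index M -> 'rV[R]_n -> 'cV[R]_n;
  form1_smooth : forall a, smooth_on (chart_im (atlas a)) (form1_loc a);
  form1_transition : forall a b (p : M),
    chart_dom (atlas a) p -> chart_dom (atlas b) p ->
    forall v : 'rV[R]_n,
      ev1 (form1_loc a (atlas a p)) v =
      ev1 (form1_loc b (atlas b p))
          ('d (transition (atlas a) (atlas b)) (atlas a p) v) }.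

Record form2 (R : realType) (n : nat) (M : manifold R n) := Form2 {
  form2_loc :> atlas_index M -> 'rV[R]_n -> 'M[R]_n;
  form2_skew : forall a x, chart_im (atlas a) x ->
    (form2_loc a x)^T = - form2_loc a x;
  form2_smooth : forall a, smooth_on (chart_im (atlas a)) (form2_loc a);
  form2_transition : forall a b (p : M),
    chart_dom (atlas a) p -> chart_dom (atlas b) p ->
    forall v w : 'rV[R]_n,
      ev2 (form2_loc a (atlas a p)) v w =
      ev2 (form2_loc b (atlas b p))
          ('d (transition (atlas a) (atlas b)) (atlas a p) v)
          ('d (transition (atlas a) (atlas b)) (atlas a p) w) }.

(* The invariant formulas for the exterior derivative, evaluated on the        *)
(* constant (hence commuting) vector fields u, v, w of a chart.                *)
Definition ext_d1 (R : realType) (n : nat) (eta : 'rV[R]_n -> 'cV[R]_n)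
    (x u v : 'rV[R]_n) : R :=
  'D_u (fun y => ev1 (eta y) v) x - 'D_v (fun y => ev1 (eta y) u) x.

Definition ext_d2 (R : realType) (n : nat) (omega : 'rV[R]_n -> 'M[R]_n)
    (x u v w : 'rV[R]_n) : R :=
  'D_u (fun y => ev2 (omega y) v w) x - 'D_v (fun y => ev2 (omega y) u w) x
  + 'D_w (fun y => ev2 (omega y) u v) x.

Definition closed_form1 (R : realType) (n : nat) (M : manifold R n)
    (eta : form1 M) : Prop :=
  forall a x, chart_im (atlas a) x -> forall u v, ext_d1 (eta a) x u v = 0.

Definition closed_form2 (R : realType) (n : nat) (M : manifold R n)
    (omega : form2 M) : Prop :=
  forall a x, chart_im (atlas a) x -> forall u v w, ext_d2 (omega a) x u v w = 0.

Definition is_pullback1 (R : realType) (m n : nat) (M : manifold R m)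
    (N : manifold R n) (f : M -> N) (theta : form1 N) (eta : form1 M) : Prop :=
  forall (p : M) a b,
    chart_dom (atlas a) p -> chart_dom (atlas b) (f p) ->
    forall v : 'rV[R]_m,
      ev1 (theta b (atlas b (f p)))
          ('d (local_expr f (atlas a) (atlas b)) (atlas a p) v) =
      ev1 (eta a (atlas a p)) v.

Definition is_pullback2 (R : realType) (m n : nat) (M : manifold R m)
    (N : manifold R n) (f : M -> N) (theta : form2 N) (omega : form2 M) : Prop :=
  forall (p : M) a b,
    chart_dom (atlas a) p -> chart_dom (atlas b) (f p) ->
    forall v w : 'rV[R]_m,
      ev2 (theta b (atlas b (f p)))
          ('d (local_expr f (atlas a) (atlas b)) (atlas a p) v)
          ('d (local_expr f (atlas a) (atlas b)) (atlas a p) w) =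
      ev2 (omega a (atlas a p)) v w.

Record k_precosymplectic (R : realType) (n k : nat) := KPreCosymplectic {
  kpc_manifold :> manifold R n;
  kpc_eta : 'I_k -> form1 kpc_manifold;
  kpc_omega : 'I_k -> form2 kpc_manifold;
  kpc_eta_closed : forall i, closed_form1 (kpc_eta i);
  kpc_omega_closed : forall j, closed_form2 (kpc_omega j) }.

(* A field of sets of tangent vectors: [D a p] consists of the components, in  *)
(* the chart [atlas a], of the vectors at p.                                   *)
Definition tangent_field (R : realType) (n : nat) (M : manifold R n) : Type :=
  atlas_index M -> M -> set 'rV[R]_n.

Definition char_distribution (R : realType) (n k : nat)
    (M : k_precosymplectic R n k) : tangent_field M :=
  fun a p => [set v : 'rV[R]_n |
    (forall i, ev1 (kpc_eta M i a (atlas a p)) v = 0) /\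
    (forall j (w : 'rV[R]_n), ev2 (kpc_omega M j a (atlas a p)) v w = 0)].
Arguments char_distribution {R n k} M a p.

(* D is spanned, around each point, by r smooth vector fields (the rows of F)  *)
(* that are linearly independent at each point.                                *)
Definition smooth_distribution (R : realType) (n : nat) (M : manifold R n)
    (D : tangent_field M) (r : nat) : Prop :=
  forall a (p : M), chart_dom (atlas a) p ->
  exists (U : set 'rV[R]_n) (F : 'rV[R]_n -> 'M[R]_(r, n)),
    [/\ open U, U (atlas a p), U `<=` chart_im (atlas a), smooth_on U F &
        forall q : M, chart_dom (atlas a) q -> U (atlas a q) ->
          row_free (F (atlas a q)) /\
          forall v : 'rV[R]_n, D a q v <-> (v <= F (atlas a q))%MS].

Definition constant_rank1 (R : realType) (n : nat) (M : manifold R n)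
    (eta : form1 M) : Prop :=
  exists r : nat, forall a (p : M), chart_dom (atlas a) p ->
    \rank (eta a (atlas a p)) = r.

Definition constant_rank2 (R : realType) (n : nat) (M : manifold R n)
    (omega : form2 M) : Prop :=
  exists r : nat, forall a (p : M), chart_dom (atlas a) p ->
    \rank (omega a (atlas a p)) = r.

Definition nowhere_zero (R : realType) (n : nat) (M : manifold R n)
    (eta : form1 M) : Prop :=
  forall a (p : M), chart_dom (atlas a) p -> eta a (atlas a p) <> 0.

Record standing_assumptions (R : realType) (n k : nat)
    (M : k_precosymplectic R n k) : Prop := StandingAssumptions {
  sa_eta_rank : forall i, constant_rank1 (kpc_eta M i);
  sa_omega_rank : forall j, constant_rank2 (kpc_omega M j);
  sa_eta_neq0 : forall i, nowhere_zero (kpc_eta M i);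
  sa_char_distribution :
    exists r : nat, smooth_distribution (char_distribution M) r }.

Record k_cosymplectic (R : realType) (n k : nat) := KCosymplectic {
  kc_pre :> k_precosymplectic R n k;
  kc_char_trivial : forall a (p : kc_pre), chart_dom (atlas a) p ->
    char_distribution kc_pre a p = [set 0] }.

(* phi belongs to the maximal atlas of M and maps S to the coordinate subspace *)
(* where all but the first d coordinates vanish.                               *)
Definition slice_chart (R : realType) (n : nat) (M : manifold R n) (S : set M)
    (d : nat) (phi : chart R M n) : Prop :=
  (forall a, compatible (atlas a) phi) /\
  (forall p : M, chart_dom phi p ->
     (S p <-> forall i : 'I_n, (d <= i)%N -> phi p 0 i = 0)).

Definition submanifold (R : realType) (n : nat) (M : manifold R n) (S : set M)
    (d : nat) : Prop :=
  (d <= n)%N /\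
  forall p : M, S p -> exists phi, chart_dom phi p /\ slice_chart S d phi.

Definition tangent_space (R : realType) (n : nat) (M : manifold R n)
    (S : set M) (d : nat) : tangent_field M :=
  fun a p => [set v : 'rV[R]_n |
    exists phi, [/\ chart_dom phi p, slice_chart S d phi &
      forall i : 'I_n, (d <= i)%N ->
        ('d (transition (atlas a) phi) (atlas a p) v : 'rV[R]_n) 0 i = 0]].

(* The first l forms are those of index 0, ..., l - 1 in 'I_k. *)
Definition coisotropic (R : realType) (n k : nat) (M : k_cosymplectic R n k)
    (l : nat) (S : set M) : Prop :=
  (1 <= l <= k)%N /\
  exists2 d, submanifold S d &
    forall a (p : M), S p -> chart_dom (atlas a) p ->
      [set v : 'rV[R]_n |
        (forall i : 'I_k, (i < l)%N ->
           ev1 (kpc_eta M i a (atlas a p)) v = 0) /\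
        (forall j : 'I_k, (j < l)%N ->
           forall w, tangent_space S d a p w ->
             ev2 (kpc_omega M j a (atlas a p)) v w = 0)]
      `<=` tangent_space S d a p.

(* Main.v *)
Require Import Defs.
From HB Require Import structures.
From mathcomp Require Import all_boot all_order all_algebra.
From mathcomp Require Import all_classical all_reals all_analysis.
From mathcomp Require Import ring lra.
Import Order.TTheory GRing.Theory Num.Theory.
Import numFieldNormedType.Exports.

(** The ambient manifold is a neighbourhood of the zero section in the total
    space of the characteristic bundle V, the subbundle of TM formed by the
    vectors killed by every eta_i and every omega_j.  A Riemannian metric g on M
    turns a vector xi of V at q into the covector g(xi, -), so it gives the
    total space a tautological one-form lambda: at xi it sends a tangent vector
    X to g(xi, pi_* X), where pi is the projection to M.  Put

      etat_i = pi^* eta_i,   omegat_j = pi^* omega_j + d lambda.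

    These forms are closed, and they restrict to eta_i and omega_j on the zero
    section, where lambda vanishes.  Along the zero section a tangent vector is
    a pair (v, xi) with v in TM and xi in V, and there

      omegat_j((v, xi), (w, zeta))
        = omega_j(v, w) + g(xi, w) - g(zeta, v).

    Suppose that omegat_j((v, xi), (w, 0)) = 0 for some j and every w in TM.  Taking
    w = xi, which omega_j kills, gives g(xi, xi) = 0, hence xi = 0 because g is
    definite.  This is at once the k-coisotropy of the zero section
    ([zero_section_coisotropic]) and the first half of the nondegeneracy of the new
    forms: if (v, 0) is moreover characteristic then v lies in V, and pairing
    with (0, v) gives g(v, v) = 0, so v = 0 ([char_trivial0]).
    Since triviality of the characteristic distribution is the nonvanishing of
    a determinant ([char_trivial_unit]), it persists on an open neighbourhood of
    the zero section; this neighbourhood is the k-cosymplectic manifold.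

    In coordinates, a local frame of V trivialises the total space over a chart
    of M, and the changes of trivialisation are given by a smooth matrix cocycle
    ([cocycleM], [smooth_at_cocycle]).  As a set the total space is taken to be
    the product of M with the space of r-rows, an r-row at q being read in a
    frame chosen once for all at q.  The choice of frames is arbitrary, so the
    topology is not the product one; it is the one for which the charts are
    homeomorphisms ([glued_manifold]).

    The analytic input is the symmetry of second derivatives ([derive_schwarz]),
    which gives d d lambda = 0 and the independence of d lambda of the chart
    ([extd1_closed], [extd1_pullback]), and a locally finite family of bump
    functions, which gives the metric ([riemannian_metric]). *)

Set Implicit Arguments.
Unset Strict Implicit.
Unset Printing Implicit Defensive.

Local Open Scope classical_set_scope.
Local Open Scope ring_scope.

(** * Maps of class C^r *)

Section CnCalculus.
Context {R : realType}.

Lemma near_eq_differentiable (V W : normedModType R) (f g : V -> W) (x : V) :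
  (\forall y \near x, f y = g y) -> differentiable f x -> differentiable g x.
Proof.
move=> fg df; have fgx := nbhs_singleton fg.
apply/diff_locallyP; have [cd _] := (diff_locallyP _ _).1 df.
suff eq : g \o shift x = cst (g x) + 'd f x +o_ 0 id.
  have -> : ('d g x : V -> W) = 'd f x by apply: diff_unique.
  by split.
have [_ /eqaddoP H] := (diff_locallyP _ _).1 df.
apply/eqaddoP => e e0; have := H _ e0.
move: fg; rewrite (near_shift 0 x) => fg.
apply: filterS2 fg => y; rewrite /= subr0 => fgy.
by rewrite -[(_ - _) y]/(f (y + x) - (f x + 'd f x y))
  -[X in _ -> is_true (`|X| <= _)]/(g (y + x) - (g x + 'd f x y)) fgy fgx.
Qed.

Lemma Cn_lower (V W : normedModType R) r (U : set V) (f : V -> W) :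
  Cn r.+1 U f -> Cn r U f.
Proof.
elim: r f => [|r IH] f [df cf]; first by move=> x /df/differentiable_continuous.
by split=> // v; apply/IH/cf.
Qed.

Lemma Cn_sub (V W : normedModType R) r (U U' : set V) (f : V -> W) :
  U' `<=` U -> Cn r U f -> Cn r U' f.
Proof.
move=> sU; elim: r f => [|r IH] f /=; first by move=> H x /sU/H.
by move=> [df cf]; split=> [x /sU/df|v] //; apply/IH/cf.
Qed.

(** Derivatives at a point only depend on the germ there, so [Cn r U f] is a
    condition on the points of U taken one by one.  This is what makes it local. *)
Lemma Cn_pointwise (V W : normedModType R) r (U : set V) (f : V -> W) :
  (forall x, U x -> Cn r [set x] f) -> Cn r U f.
Proof.
elim: r f => [|r IH] f H /=; first by move=> x Ux; apply: (H x).
split=> [x Ux|v]; first by have [+ _] := H x Ux; apply.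
by apply: IH => x /H[_]; apply.
Qed.

Lemma Cn_near_eq (V W : normedModType R) r (x : V) (f g : V -> W) :
  (\forall y \near x, f y = g y) -> Cn r [set x] f -> Cn r [set x] g.
Proof.
elim: r f g => [|r IH] f g fg /=.
  move=> cf _ ->; have := cf x erefl.
  rewrite /prop_for /= /continuous_at (nbhs_singleton fg) => {}cf.
  by apply: cvg_trans cf; apply: near_eq_cvg.
move=> [df cf]; split=> [_ ->|v]; first exact: near_eq_differentiable fg (df x _).
apply: IH (cf v).
have := near_join fg; apply: filterS => y; exact: near_eq_derive.
Qed.

Lemma Cn_eq (V W : normedModType R) r (U : set V) (f g : V -> W) :
  open U -> (forall y, U y -> f y = g y) -> Cn r U f -> Cn r U g.
Proof.
move=> oU fg cf; apply: Cn_pointwise => x Ux.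
apply: Cn_near_eq (Cn_sub _ cf); last by move=> _ ->.
by apply: filterS fg _; apply: open_nbhs_nbhs.
Qed.

Lemma Cn_cst (V W : normedModType R) r (U : set V) (c : W) : Cn r U (fun=> c).
Proof.
elim: r c => [|r IH] c; first by move=> x _; apply: cvg_cst.
split=> [x _|v]; first exact: differentiable_cst.
rewrite (_ : (fun x => 'D_v _ x) = fun=> 0); first exact: IH.
by apply/funext => x; apply: derive_cst.
Qed.

Lemma CnD (V W : normedModType R) r (U : set V) (f g : V -> W) : open U ->
  Cn r U f -> Cn r U g -> Cn r U (fun x => f x + g x).
Proof.
move=> oU; elim: r f g => [|r IH] f g.
  by move=> cf cg x Ux; apply: cvgD; [apply: cf|apply: cg].
move=> [df cf] [dg cg]; split=> [x Ux|v].
  by apply: (@differentiableD _ _ _ f g); [apply: df|apply: dg].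
apply: Cn_eq (IH _ _ (cf v) (cg v)) => // x Ux.
by rewrite (deriveD (f := f) (g := g))//; apply: diff_derivable; [apply: df|apply: dg].
Qed.

Lemma CnM (V : normedModType R) r (U : set V) (f g : V -> R) : open U ->
  Cn r U f -> Cn r U g -> Cn r U (fun x => f x * g x).
Proof.
move=> oU; elim: r f g => [|r IH] f g.
  by move=> cf cg x Ux; apply: cvgM; [apply: cf|apply: cg].
move=> F G; have [[df cf] [dg cg]] := (F, G); split=> [x Ux|v].
  by apply: (differentiableM (f := f) (g := g)); [apply: df|apply: dg].
apply: (Cn_eq (f := fun x => f x * 'D_v g x + g x * 'D_v f x)) => //.
  move=> x Ux.
  by rewrite (deriveM (f := f) (g := g))//; apply: diff_derivable; [apply: df|apply: dg].
apply: CnD => //; apply: IH => //.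
- exact: (Cn_lower F).
- exact: cg.
- exact: (Cn_lower G).
- exact: cf.
Qed.

Lemma CnV (V : normedModType R) r (U : set V) (f : V -> R) : open U ->
  (forall x, U x -> f x != 0) ->
  Cn r U f -> Cn r U (fun x => (f x)^-1).
Proof.
move=> oU f0; elim: r => [|r IH].
  by move=> cf x Ux; apply: cvgV; [apply: f0|apply: cf].
move=> F; have [df cf] := F; split=> [x Ux|v].
  apply: (differentiableV (f := f)); [exact: df|exact: f0].
apply: (Cn_eq (f := fun x => - 1 * ((f x)^-1 * (f x)^-1 * 'D_v f x))) => //.
  move=> x Ux; rewrite (deriveV (f := f))//; last by apply/diff_derivable/df.
    by rewrite mulN1r -scaleNr /= -expr2 exprVn.
  exact: f0.
have cV : Cn r U (fun x => (f x)^-1) by apply/IH; apply: (Cn_lower F).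
apply: CnM => //; first exact: Cn_cst.
by apply: CnM => //; [apply: CnM|exact: cf].
Qed.

Lemma Cn_sum (V W : normedModType R) (I : Type) (s : seq I) (P : pred I) r
    (U : set V) (f : I -> V -> W) : open U ->
  (forall i, P i -> Cn r U (f i)) -> Cn r U (fun x => \sum_(i <- s | P i) f i x).
Proof.
move=> oU H; elim: s => [|i s IH].
  by apply: Cn_eq (Cn_cst r U 0) => // x _; rewrite big_nil.
case: (boolP (P i)) => Pi.
  by apply: Cn_eq (CnD oU (H i Pi) IH) => // x _; rewrite big_cons Pi.
by apply: Cn_eq IH => // x _; rewrite big_cons (negbTE Pi).
Qed.

Lemma Cn_mx (V : normedModType R) r m n (U : set V) (f : V -> 'M[R]_(m, n)) :
  open U -> (forall i j, Cn r U (fun x => f x i j)) -> Cn r U f.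
Proof.
have fE (g : V -> 'M[R]_(m, n)) : g =
    (fun x : V => \sum_i \sum_j g x i j *: (delta_mx i j : 'M[R]_(m, n))).
  apply/funext => x; exact: matrix_sum_delta.
have dif (g : V -> 'M[R]_(m, n)) x : (forall i j, differentiable (fun x : V => g x i j) x) ->
    differentiable g x.
  move=> dg; rewrite (fE g).
  have -> : (fun x : V => \sum_i \sum_j g x i j *: (delta_mx i j : 'M[R]_(m, n))) =
     \sum_i \sum_j (fun x : V => g x i j *: (delta_mx i j : 'M[R]_(m, n))).
    apply/funext => y; rewrite fct_sumE; apply: eq_bigr => i _.
    by rewrite fct_sumE.
  apply: differentiable_sum => i; apply: differentiable_sum => j.
  exact: differentiableZl.
move=> oU; elim: r f => [|r IH] f H.
  move=> x Ux; apply/cvgrPdist_le => e e0.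
  near=> y; rewrite [leLHS]mx_normrE (bigmax_le _ (ltW e0))//= => -[i j] _.
  rewrite !mxE /=; move: i j; near: y.
  have : \forall y \near x, forall ij : 'I_m * 'I_n, `|f x ij.1 ij.2 - f y ij.1 ij.2| <= e.
    apply: filter_forall => -[i j] /=.
    by have /cvgrPdist_le := H i j x Ux; apply.
  by apply: filterS => y Hy i j; apply: (Hy (i, j)).
have df x : U x -> differentiable f x.
  by move=> Ux; apply: dif => i j; have [+ _] := H i j; apply.
split=> // v; apply: IH => i j.
have [_ /(_ v) cf] := H i j; apply: Cn_eq cf => // x Ux.
by rewrite derive_mx ?mxE//; apply/diff_derivable/df.
Unshelve. all: by end_near. Qed.

Lemma Cn_coord (V : normedModType R) r m n (U : set V) (f : V -> 'M[R]_(m, n)) i j :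
  open U -> Cn r U f -> Cn r U (fun x => f x i j).
Proof.
move=> oU; elim: r f => [|r IH] f H.
  move=> x Ux.
  apply: (continuous_comp (g := fun A : 'M[R]_(m, n) => A i j) (H x Ux)).
  exact: coord_continuous.
have [df cf] := H; split=> [x Ux|v].
  apply: (differentiable_comp (g := fun A : 'M[R]_(m, n) => A i j)).
    exact: df.
  exact: differentiable_coord.
apply: Cn_eq (IH _ (cf v)) => // x Ux.
by rewrite derive_mx ?mxE//; apply/diff_derivable/df.
Qed.

(** Induction needs a formula for the derivative of g o f in which only
    directional derivatives along fixed vectors occur: the derivative of f is
    expanded in the canonical basis, D_v (g o f) = sum_i (D_v f)_i (D_i g o f). *)
Lemma Cn_comp_rV (V : normedModType R) n r (U : set V) (U' : set 'rV[R]_n)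
    (f : V -> 'rV[R]_n) (g : 'rV[R]_n -> R) : open U ->
  (forall x, U x -> U' (f x)) ->
  Cn r U f -> Cn r U' g -> Cn r U (fun x => g (f x)).
Proof.
move=> oU fU; elim: r g => [|r IH] g F G.
  by move=> x Ux; apply: (continuous_comp (g := g) (F x Ux)); apply/G/fU.
have [[df cf] [dg cg]] := (F, G); split=> [x Ux|v].
  by apply: (differentiable_comp (g := g)); [apply: df|apply/dg/fU].
apply: (Cn_eq (f := fun x => \sum_i 'D_v f x 0 i * 'D_(delta_mx 0 i) g (f x))) => //.
  move=> x Ux; have [dfx dgx] := (df _ Ux, dg _ (fU _ Ux)).
  rewrite (deriveE (f := fun x => g (f x))); last first.
    by apply: (differentiable_comp (g := g)); [apply: df|apply/dg/fU].
  rewrite (diff_comp (f := f) (g := g)) //=.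
  rewrite deriveE//.
  rewrite {2}(row_sum_delta ('d f x v)) linear_sum.
  by apply: eq_bigr => i _; rewrite linearZ deriveE.
apply: Cn_sum => // i _; apply: CnM => //.
  exact: (Cn_coord (f := 'D_v f) 0 i oU (cf v)).
by apply: (IH ('D_(delta_mx 0 i) g)); [exact: (Cn_lower F)|exact: cg].
Qed.

Lemma Cn_comp_R (V : normedModType R) r (U : set V) (U' : set R)
    (f : V -> R) (g : R -> R) : open U ->
  (forall x, U x -> U' (f x)) ->
  Cn r U f -> Cn r U' g -> Cn r U (fun x => g (f x)).
Proof.
move=> oU fU; elim: r g => [|r IH] g F G.
  by move=> x Ux; apply: (continuous_comp (g := g) (F x Ux)); apply/G/fU.
have [[df cf] [dg cg]] := (F, G); split=> [x Ux|v].
  by apply: (differentiable_comp (g := g)); [apply: df|apply/dg/fU].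
apply: (Cn_eq (f := fun x => 'D_v f x * 'D_1 g (f x))) => //.
  move=> x Ux; have [dfx dgx] := (df _ Ux, dg _ (fU _ Ux)).
  rewrite (deriveE (f := fun x => g (f x))); last first.
    by apply: (differentiable_comp (g := g)); [apply: df|apply/dg/fU].
  rewrite (diff_comp (f := f) (g := g)) //=.
  rewrite deriveE//.
  rewrite deriveE//.
  have {2}-> : 'd f x v = 'd f x v *: (1 : R^o) by rewrite /GRing.scale /= mulr1.
  by rewrite linearZ.
apply: CnM => //; first exact: cf.
by apply: (IH ('D_1 g)); [exact: (Cn_lower F)|exact: cg].
Qed.

End CnCalculus.

(** * Smoothness at a point *)

Section SmoothAt.
Context {R : realType}.
Implicit Types V W : normedModType R.

Lemma near_open (T : topologicalType) (x : T) (P : T -> Prop) :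
  (\forall y \near x, P y) -> exists2 U, open_nbhs x U & forall y, U y -> P y.
Proof. by move=> xP; have : nbhs x P by []; rewrite nbhsE. Qed.

(** The germ version of [smooth_on]; all closure properties below are stated for
    it, so that domains of definition need not be tracked. *)
Definition smooth_at V W (f : V -> W) (x : V) : Prop :=
  exists2 U : set V, open_nbhs x U & smooth_on U f.

Lemma smooth_onW V W (U : set V) (f : V -> W) x :
  open U -> smooth_on U f -> U x -> smooth_at f x.
Proof. by move=> oU fU Ux; exists U. Qed.

Lemma smooth_onP V W (U : set V) (f : V -> W) :
  (forall x, U x -> smooth_at f x) -> smooth_on U f.
Proof.
move=> H r; apply: Cn_pointwise => x /H[U' [oU' U'x] /(_ r)].
by apply: Cn_sub => _ ->.
Qed.

Lemma smooth_at_near V W (f : V -> W) x :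
  smooth_at f x -> \forall y \near x, smooth_at f y.
Proof.
move=> [U oU fU]; apply: filterS (open_nbhs_nbhs oU) => y Uy.
by apply: smooth_onW Uy => //; case: oU.
Qed.

Lemma smooth_at_eq V W (f g : V -> W) x :
  (\forall y \near x, f y = g y) -> smooth_at f x -> smooth_at g x.
Proof.
move=> /near_open[U' [oU' U'x] fg] [U [oU Ux] fU].
exists (U `&` U'); first by split=> //; exact: openI.
move=> r; apply: Cn_eq (Cn_sub _ (fU r)); [exact: openI| |exact: subIsetl].
by move=> y [_ /fg].
Qed.

Lemma smooth_at_differentiable V W (f : V -> W) x :
  smooth_at f x -> differentiable f x.
Proof. by move=> [U [_ Ux] /(_ 1)[df _]]; exact: df. Qed.

Lemma smooth_at_continuous V W (f : V -> W) x :
  smooth_at f x -> {for x, continuous f}.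
Proof. by move=> [U [_ Ux] /(_ 0)]; exact. Qed.

Lemma smooth_at_derive V W (f : V -> W) x v :
  smooth_at f x -> smooth_at ('D_v f) x.
Proof. by move=> [U Ux fU]; exists U => // r; have [_] := fU r.+1; exact. Qed.

Lemma smooth_at_cst V W (c : W) (x : V) : smooth_at (fun=> c) x.
Proof.
exists setT => [|r]; last exact: Cn_cst.
by split=> //; exact: openT.
Qed.

Lemma smooth_atD V W (f g : V -> W) x :
  smooth_at f x -> smooth_at g x -> smooth_at (fun y => f y + g y) x.
Proof.
move=> [U [oU Ux] fU] [U' [oU' U'x] gU].
exists (U `&` U'); first by split=> //; exact: openI.
have oI : open (U `&` U') by exact: openI.
move=> r; apply: CnD => //.
  exact: Cn_sub (@subIsetl _ _ _) (fU r).
exact: Cn_sub (@subIsetr _ _ _) (gU r).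
Qed.

Lemma smooth_atM V (f g : V -> R) x :
  smooth_at f x -> smooth_at g x -> smooth_at (fun y => f y * g y) x.
Proof.
move=> [U [oU Ux] fU] [U' [oU' U'x] gU].
exists (U `&` U'); first by split=> //; exact: openI.
have oI : open (U `&` U') by exact: openI.
move=> r; apply: CnM => //.
  exact: Cn_sub (@subIsetl _ _ _) (fU r).
exact: Cn_sub (@subIsetr _ _ _) (gU r).
Qed.

Lemma smooth_atV V (f : V -> R) x :
  smooth_at f x -> f x != 0 -> smooth_at (fun y => (f y)^-1) x.
Proof.
move=> fx fx0; have [U [oU Ux] fU] := fx.
have : \forall y \near x, f y != 0 /\ U y.
  apply: filterI; last exact: open_nbhs_nbhs.
  by have /cvgr_neq0 := smooth_at_continuous fx; apply.
move=> /near_open[U' [oU' U'x] sU']; exists U' => // r.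
by apply: CnV (Cn_sub _ (fU r)) => // y /sU'[].
Qed.

Lemma smooth_at_sum V W (I : Type) (s : seq I) (P : pred I) (f : I -> V -> W) x :
  (forall i, P i -> smooth_at (f i) x) ->
  smooth_at (fun y => \sum_(i <- s | P i) f i y) x.
Proof.
move=> H; elim: s => [|i s IH].
  by under eq_fun do rewrite big_nil; exact: smooth_at_cst.
under eq_fun do rewrite big_cons.
by case: (boolP (P i)) => // /H fi; exact: smooth_atD.
Qed.

Lemma smooth_at_prod V (I : Type) (s : seq I) (P : pred I) (f : I -> V -> R) x :
  (forall i, P i -> smooth_at (f i) x) ->
  smooth_at (fun y => \prod_(i <- s | P i) f i y) x.
Proof.
move=> H; elim: s => [|i s IH].
  by under eq_fun do rewrite big_nil; exact: smooth_at_cst.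
under eq_fun do rewrite big_cons.
by case: (boolP (P i)) => // /H fi; exact: smooth_atM.
Qed.

Lemma smooth_at_coord V m n (f : V -> 'M[R]_(m, n)) x i j :
  smooth_at f x -> smooth_at (fun y => f y i j) x.
Proof. by move=> [U [oU Ux] fU]; exists U => // r; exact: Cn_coord. Qed.

Lemma smooth_at_mx V m n (f : V -> 'M[R]_(m, n)) x :
  (forall i j, smooth_at (fun y => f y i j) x) -> smooth_at f x.
Proof.
move=> H.
have : \forall y \near x, forall ij : 'I_m * 'I_n, forall r,
    Cn r [set y] (fun y => f y ij.1 ij.2).
  apply: filter_forall => -[i j] /=.
  have [U oU fU] := H i j; apply: filterS (open_nbhs_nbhs oU) => y Uy r.
  by apply: Cn_sub (fU r) => _ ->.
move=> /near_open[U [oU Ux] sU]; exists U => // r.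
apply: Cn_mx => // i j; apply: Cn_pointwise => y /sU H'.
exact: (H' (i, j)).
Qed.

Lemma smooth_at_comp V n (f : V -> 'rV[R]_n) (g : 'rV[R]_n -> R) x :
  smooth_at f x -> smooth_at g (f x) -> smooth_at (fun y => g (f y)) x.
Proof.
move=> fx [U' oU' gU']; have [U oU fU] := fx.
have : \forall y \near x, U' (f y) /\ U y.
  apply: filterI; last exact: open_nbhs_nbhs.
  by apply: (smooth_at_continuous fx); exact: open_nbhs_nbhs.
move=> /near_open[U2 [oU2 U2x] sU2]; exists U2 => // r.
apply: Cn_comp_rV (Cn_sub _ (fU r)) (gU' r) => // y /sU2[] //.
Qed.

Lemma smooth_at_comp_mx V n p q (f : V -> 'rV[R]_n) (g : 'rV[R]_n -> 'M[R]_(p, q)) x :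
  smooth_at f x -> smooth_at g (f x) -> smooth_at (fun y => g (f y)) x.
Proof.
move=> fx gx; apply: smooth_at_mx => i j.
have gij : smooth_at (fun z => g z i j) (f x) by exact: smooth_at_coord.
exact: (smooth_at_comp fx gij).
Qed.

Lemma smooth_at_comp_R V (f : V -> R) (g : R -> R) x :
  smooth_at f x -> smooth_at g (f x) -> smooth_at (fun y => g (f y)) x.
Proof.
move=> fx [U' oU' gU']; have [U oU fU] := fx.
have : \forall y \near x, U' (f y) /\ U y.
  apply: filterI; last exact: open_nbhs_nbhs.
  by apply: (smooth_at_continuous fx); exact: open_nbhs_nbhs.
move=> /near_open[U2 [oU2 U2x] sU2]; exists U2 => // r.
apply: Cn_comp_R (Cn_sub _ (fU r)) (gU' r) => // y /sU2[] //.
Qed.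

Lemma smooth_at_id m n (x : 'M[R]_(m, n)) : smooth_at id x.
Proof.
apply: smooth_at_mx => i j; exists setT => [|r]; first by split=> //; exact: openT.
case: r => [|r]; first by move=> y _; exact: coord_continuous.
split=> [y _|v]; first exact: differentiable_coord.
rewrite (_ : (fun y => 'D_v _ y) = fun=> v i j); first exact: Cn_cst.
apply/funext => y; rewrite -[RHS](congr1 (fun A : 'M[R]_(m, n) => A i j) (derive_id y v)).
by rewrite derive_mx ?mxE//; exact: derivable_id.
Qed.

Lemma smooth_at_mulmx V m n p (f : V -> 'M[R]_(m, n)) (g : V -> 'M[R]_(n, p)) x :
  smooth_at f x -> smooth_at g x -> smooth_at (fun y => f y *m g y) x.
Proof.
move=> fx gx; apply: smooth_at_mx => i j.
under eq_fun do rewrite mxE.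
by apply: smooth_at_sum => k _; apply: smooth_atM; exact: smooth_at_coord.
Qed.

Lemma smooth_at_trmx V m n (f : V -> 'M[R]_(m, n)) x :
  smooth_at f x -> smooth_at (fun y => (f y)^T) x.
Proof.
move=> fx; apply: smooth_at_mx => i j.
by under eq_fun do rewrite mxE; exact: smooth_at_coord.
Qed.

Lemma smooth_at_scalemx V m n (k : V -> R) (f : V -> 'M[R]_(m, n)) x :
  smooth_at k x -> smooth_at f x -> smooth_at (fun y => k y *: f y) x.
Proof.
move=> kx fx; apply: smooth_at_mx => i j.
under eq_fun do rewrite mxE.
by apply: smooth_atM => //; exact: smooth_at_coord.
Qed.

Lemma smooth_atN V m n (f : V -> 'M[R]_(m, n)) x :
  smooth_at f x -> smooth_at (fun y => - f y) x.
Proof.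
move=> fx; under eq_fun do rewrite -scaleN1r.
by apply: smooth_at_scalemx => //; exact: smooth_at_cst.
Qed.

Lemma smooth_at_row_mx V m n p (f : V -> 'M[R]_(m, n)) (g : V -> 'M[R]_(m, p)) x :
  smooth_at f x -> smooth_at g x -> smooth_at (fun y => row_mx (f y) (g y)) x.
Proof.
move=> fx gx; apply: smooth_at_mx => i j; case: (split_ordP j) => k ->.
  by under eq_fun do rewrite row_mxEl; exact: smooth_at_coord.
by under eq_fun do rewrite row_mxEr; exact: smooth_at_coord.
Qed.

Lemma smooth_at_col_mx V m n p (f : V -> 'M[R]_(m, n)) (g : V -> 'M[R]_(p, n)) x :
  smooth_at f x -> smooth_at g x -> smooth_at (fun y => col_mx (f y) (g y)) x.
Proof.
move=> fx gx; apply: smooth_at_mx => i j; case: (split_ordP i) => k ->.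
  by under eq_fun do rewrite col_mxEu; exact: smooth_at_coord.
by under eq_fun do rewrite col_mxEd; exact: smooth_at_coord.
Qed.

Lemma smooth_at_lsubmx V m n p (f : V -> 'M[R]_(m, n + p)) x :
  smooth_at f x -> smooth_at (fun y => lsubmx (f y)) x.
Proof.
by move=> fx; apply: smooth_at_mx => i j; under eq_fun do rewrite mxE;
  exact: smooth_at_coord.
Qed.

Lemma smooth_at_rsubmx V m n p (f : V -> 'M[R]_(m, n + p)) x :
  smooth_at f x -> smooth_at (fun y => rsubmx (f y)) x.
Proof.
by move=> fx; apply: smooth_at_mx => i j; under eq_fun do rewrite mxE;
  exact: smooth_at_coord.
Qed.

Lemma smooth_at_det V n (f : V -> 'M[R]_n) x :
  smooth_at f x -> smooth_at (fun y => \det (f y)) x.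
Proof.
move=> fx; apply: smooth_at_sum => s _; apply: smooth_atM; first exact: smooth_at_cst.
by apply: smooth_at_prod => i _; exact: smooth_at_coord.
Qed.

(** Cramer's rule: near x the inverse is the adjugate divided by the determinant. *)
Lemma smooth_at_invmx V n (f : V -> 'M[R]_n) x :
  smooth_at f x -> f x \in unitmx -> smooth_at (fun y => invmx (f y)) x.
Proof.
rewrite unitmxE unitfE => fx fx0.
have dx := smooth_at_det fx.
apply: (@smooth_at_eq _ _ (fun y => (\det (f y))^-1 *: \adj (f y))).
  have /cvgr_neq0/(_ fx0) := smooth_at_continuous dx.
  by apply: filterS => y fy; rewrite /invmx unitmxE unitfE fy.
apply: smooth_at_scalemx; first exact: smooth_atV.
apply: smooth_at_mx => i j; under eq_fun do rewrite mxE.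
apply: smooth_atM; first exact: smooth_at_cst.
apply: smooth_at_det; apply: smooth_at_mx => k l.
by under eq_fun do rewrite !mxE; exact: smooth_at_coord.
Qed.

Lemma jacobianE m n (f : 'rV[R]_m -> 'rV[R]_n) x i j :
  differentiable f x -> 'J f x i j = 'D_(delta_mx 0 i) f x 0 j.
Proof. by move=> df; rewrite (deriveEjacobian _ df) -rowE [RHS]mxE. Qed.

Lemma smooth_at_jacobian m n (f : 'rV[R]_m -> 'rV[R]_n) x :
  smooth_at f x -> smooth_at (jacobian f) x.
Proof.
move=> fx; apply: smooth_at_mx => i j.
apply: (@smooth_at_eq _ _ (fun y => 'D_(delta_mx 0 i) f y 0 j)).
  apply: filterS (smooth_at_near fx) => y fy.
  by rewrite jacobianE//; exact: smooth_at_differentiable.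
exact/smooth_at_coord/smooth_at_derive.
Qed.

Lemma near_eq_jacobian m n (f g : 'rV[R]_m -> 'rV[R]_n) x :
  (\forall y \near x, f y = g y) -> differentiable f x -> 'J f x = 'J g x.
Proof.
move=> fg df; apply/matrixP => i j.
have dg := near_eq_differentiable fg df.
apply: etrans (jacobianE i j df) _; apply: etrans _ (esym (jacobianE i j dg)).
by congr (fun_of_matrix _ 0 j); exact: near_eq_derive.
Qed.

Lemma jacobian_comp m n p (f : 'rV[R]_m -> 'rV[R]_n) (g : 'rV[R]_n -> 'rV[R]_p) x :
  differentiable f x -> differentiable g (f x) ->
  'J (g \o f) x = 'J f x *m 'J g (f x).
Proof.
move=> df dg; apply/row_matrixP => i; rewrite !rowE mulmxA.
have dgf : differentiable (g \o f) x by exact: differentiable_comp.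
rewrite -(deriveEjacobian _ dgf) -(deriveEjacobian _ df) -(deriveEjacobian _ dg).
by rewrite (deriveE _ dgf) (deriveE _ df) (deriveE _ dg) diff_comp.
Qed.

(** * Symmetry of second derivatives *)

Lemma derive_line V W (f : V -> W) (y u : V) (a : R) :
  derivable f (y + a *: u) u ->
  is_derive a 1 (fun t : R => f (y + t *: u)) ('D_u f (y + a *: u)).
Proof.
have E : (fun h : R => h^-1 *: (((fun t : R => f (y + t *: u)) \o shift a) (h *: (1 : R^o)) -
            f (y + a *: u))) =
         (fun h : R => h^-1 *: ((f \o shift (y + a *: u)) (h *: u) - f (y + a *: u))).
  apply/funext => h /=; congr (_ *: (f _ - _)).
  by rewrite [h *: 1]mulr1 scalerDl addrCA.
move=> df; split; first by rewrite /derivable E.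
by rewrite /derive E.
Qed.

(** Two applications of the mean value theorem, first along u and then along v.
    The left-hand side is symmetric in u and v, whence [derive_schwarz]. *)
Lemma second_difference V (f : V -> R) (x u v : V) (s : R) : 0 < s ->
  (forall a b, 0 <= a <= s -> 0 <= b <= s -> smooth_at f (x + a *: u + b *: v)) ->
  exists a b, [/\ 0 <= a <= s, 0 <= b <= s &
    f (x + s *: u + s *: v) - f (x + s *: u) - f (x + s *: v) + f x =
    'D_v ('D_u f) (x + a *: u + b *: v) * s ^+ 2].
Proof.
move=> s0 H.
have s00 : (0 : R) <= 0 <= s by apply/andP; split; [exact: lexx|exact: ltW].
have ss : 0 <= s <= s by apply/andP; split; [exact: ltW|exact: lexx].
have dH a b c : 0 <= a <= s -> 0 <= b <= s -> derivable f (x + a *: u + b *: v) c.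
  by move=> ha hb; apply/diff_derivable/smooth_at_differentiable/H.

have MVTs (g dg : R -> R) : (forall a, 0 <= a <= s -> is_derive a 1 g (dg a)) ->
    exists2 a, 0 <= a <= s & g s - g 0 = dg a * s.
  move=> gd.
  have [a ha||a] := @MVT_segment R g dg 0 s (ltW s0).
  - by apply: gd; rewrite !ltW ?(itvP ha).
  - apply: derivable_within_continuous => a; rewrite in_itv /= => ha.
    by have [] := gd a ha.
  - by rewrite in_itv /= subr0; exists a.
have [|a ha Ea] := MVTs (fun t : R => f (x + s *: v + t *: u) - f (x + t *: u))
    (fun a => 'D_u f (x + s *: v + a *: u) - 'D_u f (x + a *: u)).
  move=> a ha; apply: is_deriveB; apply: derive_line.
    by rewrite addrAC; exact: dH.
  by have := dH a 0 u ha s00; rewrite scale0r addr0.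
have [|b hb Eb] := MVTs (fun t : R => 'D_u f (x + a *: u + t *: v))
    (fun b => 'D_v ('D_u f) (x + a *: u + b *: v)).
  move=> b hb; apply: derive_line.
  by apply/diff_derivable/smooth_at_differentiable/smooth_at_derive/H.
exists a, b; split => //; rewrite expr2 mulrA -Eb scale0r addr0.
rewrite (addrAC x (a *: u)) -Ea /= !scale0r !addr0 (addrAC x (s *: u)); ring.
Qed.

Lemma derive_schwarz V (f : V -> R) (x u v : V) :
  smooth_at f x -> 'D_u ('D_v f) x = 'D_v ('D_u f) x.
Proof.
move=> fx.
set G := 'D_u ('D_v f); set H := 'D_v ('D_u f).
have cG : {for x, continuous G} by do 2?apply: smooth_at_continuous; do 2!apply: smooth_at_derive.
have cH : {for x, continuous H} by do 2?apply: smooth_at_continuous; do 2!apply: smooth_at_derive.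
apply/eqP; rewrite -subr_eq0 -normr_le0; apply/ler_addgt0Pr => e e0; rewrite add0r.
have e20 : 0 < e / 2 by rewrite divr_gt0.
have : \forall y \near x, [/\ smooth_at f y, `|G x - G y| < e / 2 & `|H x - H y| < e / 2].
  have nG : \forall y \near x, `|G x - G y| < e / 2.
    by move/cvgrPdist_lt: cG; apply.
  have nH : \forall y \near x, `|H x - H y| < e / 2.
    by move/cvgrPdist_lt: cH; apply.
  have nf := smooth_at_near fx.
  by apply: filterS (filterI nf (filterI nG nH)) => y [? [? ?]]; split.
move=> /nbhs_ballP[d /= d0 B].
(* The parallelogram of side s spanned by u and v then lies in the ball of radius d. *)
pose s := d / (2 * (`|u| + `|v| + 1)).
have N0 : 0 < `|u| + `|v| + 1 by rewrite ltr_wpDl// addr_ge0.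
have s0 : 0 < s by rewrite divr_gt0// mulr_gt0.
have Bs a b : 0 <= a <= s -> 0 <= b <= s -> ball x d (x + a *: u + b *: v).
  move=> /andP[a0 sa] /andP[b0 sb]; rewrite -ball_normE /= -addrA opprD addNKr normrN.
  rewrite (le_lt_trans (ler_normD _ _))// !normrZ !ger0_norm//.
  have : a * `|u| + b * `|v| <= s * (`|u| + `|v| + 1).
    by rewrite !mulrDr mulr1 -[leLHS]addr0 !lerD// ?ler_wpM2r// ltW.
  move=> /le_lt_trans; apply; rewrite /s invfM mulrA mulfVK ?gt_eqF//.
  by rewrite ltr_pdivrMr// ltr_pMr// ltr1n.
have [a [b [ha hb E]]] := @second_difference V f x u v s s0
  (fun a b ha hb => let: And3 h _ _ := B _ (Bs a b ha hb) in h).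
have [a' [b' [ha' hb' E']]] := @second_difference V f x v u s s0
  (fun a b ha hb => let: And3 h _ _ :=
     B _ (eq_ind _ (ball x d) (Bs b a hb ha) _ (addrAC _ _ _)) in h).
(* Both second derivatives are the same second difference divided by s ^ 2,
   evaluated at points as close to x as desired. *)
have EE : H (x + a *: u + b *: v) = G (x + b' *: u + a' *: v).
  apply: (@mulIf _ (s ^+ 2)); first by rewrite expf_neq0// gt_eqF.
  rewrite (addrAC x (a' *: v)) (addrAC x (s *: v)) in E'.
  by apply: etrans (esym E) (etrans _ E'); congr (_ + _); exact: addrAC.
have [_ hG _] := B _ (Bs _ _ hb' ha'); have [_ _ hH] := B _ (Bs _ _ ha hb).
rewrite EE in hH; rewrite distrC in hH.
have := le_lt_trans (ler_normD _ _) (ltrD hG hH).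
by rewrite addrA subrK -splitr => /ltW.
Qed.

End SmoothAt.

(** * The exterior derivative of a one-form in coordinates *)

Section ExteriorDerivative.
Context {R : realType}.
Implicit Types V W : normedModType R.

Lemma derive_coord V m n (f : V -> 'M[R]_(m, n)) x v i j :
  differentiable f x -> 'D_v (fun y => f y i j) x = ('D_v f x) i j.
Proof. by move=> df; rewrite derive_mx ?mxE//; exact: diff_derivable. Qed.

Lemma differentiable_mulmx V m n p (f : V -> 'M[R]_(m, n)) (g : V -> 'M[R]_(n, p)) x v :
  differentiable f x -> differentiable g x ->
  is_derive x v (fun y => f y *m g y) ('D_v f x *m g x + f x *m 'D_v g x).
Proof.
move=> df dg.
have key i j : is_derive x v (fun y => (f y *m g y) i j)
    (('D_v f x *m g x + f x *m 'D_v g x) i j).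
  have -> : (fun y => (f y *m g y) i j) = \sum_(k < n) (fun y => f y i k * g y k j).
    by apply/funext => y; rewrite mxE fct_sumE.
  have -> : ('D_v f x *m g x + f x *m 'D_v g x) i j =
     \sum_(k < n) (f x i k *: 'D_v (fun y => g y k j) x + g x k j *: 'D_v (fun y => f y i k) x).
    rewrite !mxE -big_split /=; apply: eq_bigr => k _.
    by rewrite !derive_coord// /GRing.scale /= addrC [in X in _ = _ + X]mulrC.
  apply: is_derive_sum => k; apply: is_deriveM; apply/derivableP/diff_derivable.
    apply: (differentiable_comp (g := fun A : 'M[R]_(m, n) => A i k)) => //.
    exact: differentiable_coord.
  apply: (differentiable_comp (g := fun A : 'M[R]_(n, p) => A k j)) => //.
  exact: differentiable_coord.
have dM : derivable (fun y => f y *m g y) x v.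
  by apply/derivable_mxP => i j; case: (key i j).
split=> //; rewrite derive_mx//; apply/matrixP => i j; rewrite mxE.
by case: (key i j).
Qed.

Lemma derive_schwarz_mx V m n (f : V -> 'M[R]_(m, n)) x u v :
  smooth_at f x -> 'D_u ('D_v f) x = 'D_v ('D_u f) x.
Proof.
move=> fx; apply/matrixP => i j.
have E w w' : ('D_w ('D_w' f) x) i j = 'D_w ('D_w' (fun y => f y i j)) x.
  rewrite -(derive_coord w i j (smooth_at_differentiable (smooth_at_derive w' fx))).
  apply: near_eq_derive; apply: filterS (smooth_at_near fx) => y fy.
  exact: esym (derive_coord w' i j (smooth_at_differentiable fy)).
apply: etrans (E u v) (etrans _ (esym (E v u))).
exact/derive_schwarz/smooth_at_coord.
Qed.

(** A one-form is a column of components; the jacobian of its transpose is the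
    matrix of partial derivatives (d_i lam_j), so this is the skew matrix with
    entries d_i lam_j - d_j lam_i. *)
Definition extd1 m (lam : 'rV[R]_m -> 'cV[R]_m) (x : 'rV[R]_m) : 'M[R]_m :=
  'J (fun y => (lam y)^T) x - ('J (fun y => (lam y)^T) x)^T.

Lemma extd1_skew m (lam : 'rV[R]_m -> 'cV[R]_m) x : (extd1 lam x)^T = - extd1 lam x.
Proof. by rewrite /extd1 linearB /= trmxK opprB. Qed.

Lemma smooth_at_extd1 m (lam : 'rV[R]_m -> 'cV[R]_m) x :
  smooth_at lam x -> smooth_at (extd1 lam) x.
Proof.
move=> lx; have Jx := smooth_at_jacobian (smooth_at_trmx lx).
by apply: smooth_atD => //; apply/smooth_atN/smooth_at_trmx.
Qed.

Lemma trmx11 (A : 'M[R]_1) : A^T = A.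
Proof. by apply/matrixP => i j; rewrite mxE !ord1. Qed.

Lemma ev2_trmx m (A : 'M[R]_m) u v : ev2 A^T u v = ev2 A v u.
Proof.
rewrite /ev2; congr ((_ : 'M[R]_1) 0 0).
by rewrite -[RHS]trmx11 !trmx_mul trmxK mulmxA.
Qed.

Lemma ev2D m (A B : 'M[R]_m) u v : ev2 (A + B) u v = ev2 A u v + ev2 B u v.
Proof. by rewrite /ev2 mulmxDr mulmxDl mxE. Qed.

Lemma ev2N m (A : 'M[R]_m) u v : ev2 (- A) u v = - ev2 A u v.
Proof. by rewrite /ev2 mulmxN mulNmx mxE. Qed.

Lemma ev2_skew m (A : 'M[R]_m) u v : A^T = - A -> ev2 A u v = - ev2 A v u.
Proof. by move=> sA; rewrite -ev2_trmx sA ev2N. Qed.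

Lemma derive_ev1 m (lam : 'rV[R]_m -> 'cV[R]_m) x u v : smooth_at lam x ->
  'D_u (fun y => ev1 (lam y) v) x = ev2 ('J (fun y => (lam y)^T) x) u v.
Proof.
move=> lx; have ltx := smooth_at_differentiable (smooth_at_trmx lx).
rewrite /ev2 -deriveEjacobian//.
have [_ E] := differentiable_mulmx u ltx (differentiable_cst v^T x).
rewrite derive_cst mulmx0 addr0 in E; rewrite -E -derive_coord; last first.
  by apply/smooth_at_differentiable/smooth_at_mulmx => //;
    [exact: smooth_at_trmx|exact: smooth_at_cst].
congr ('D_u _ x); apply/funext => y.
by rewrite /ev1 -[v *m _]trmx11 trmx_mul.
Qed.

Lemma ev2_extd1 m (lam : 'rV[R]_m -> 'cV[R]_m) x u v :
  smooth_at lam x -> ev2 (extd1 lam x) u v = ext_d1 lam x u v.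
Proof. by move=> lx; rewrite /ext_d1 !derive_ev1// /extd1 ev2D ev2N ev2_trmx. Qed.

Lemma smooth_at_ev1 V m (lam : V -> 'cV[R]_m) (v : V -> 'rV[R]_m) x :
  smooth_at lam x -> smooth_at v x -> smooth_at (fun y => ev1 (lam y) (v y)) x.
Proof. by move=> lx vx; apply/smooth_at_coord/smooth_at_mulmx. Qed.

Lemma smooth_at_ev2 V m (A : V -> 'M[R]_m) (u v : 'rV[R]_m) x :
  smooth_at A x -> smooth_at (fun y => ev2 (A y) u v) x.
Proof.
move=> Ax; apply/smooth_at_coord/smooth_at_mulmx; last exact: smooth_at_cst.
by apply/smooth_at_mulmx => //; exact: smooth_at_cst.
Qed.

(** The six second derivatives of lam cancel in pairs by symmetry. *)
Lemma extd1_closed m (lam : 'rV[R]_m -> 'cV[R]_m) x u v w :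
  smooth_at lam x -> ext_d2 (extd1 lam) x u v w = 0.
Proof.
move=> lx.
have E (a b c : 'rV[R]_m) : 'D_a (fun y => ev2 (extd1 lam y) b c) x =
    'D_a ('D_b (fun y => ev1 (lam y) c)) x - 'D_a ('D_c (fun y => ev1 (lam y) b)) x.
  have s d e : smooth_at ('D_d (fun y => ev1 (lam y) e)) x.
    by apply/smooth_at_derive/smooth_at_ev1 => //; exact: smooth_at_cst.
  rewrite -deriveB; first last.
  - exact/diff_derivable/smooth_at_differentiable.
  - exact/diff_derivable/smooth_at_differentiable.
  apply: near_eq_derive; apply: filterS (smooth_at_near lx) => y ly.
  by rewrite ev2_extd1.
have S a b c : 'D_a ('D_b (fun y => ev1 (lam y) c)) x = 'D_b ('D_a (fun y => ev1 (lam y) c)) x.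
  by apply/derive_schwarz/smooth_at_ev1 => //; exact: smooth_at_cst.
rewrite /ext_d2 (E u v w) (E v u w) (E w u v) {E}.
move: (S u v w) (S u w v) (S v w u); clear.
set a := ('D_u _ x); set b := ('D_u _ x); set c := ('D_v _ x).
set d := ('D_v _ x); set e := ('D_w _ x); set f := ('D_w _ x).
by move=> -> -> ->; ring.
Qed.

(** The exterior derivative commutes with pullback: differentiating the relation
    between lam and mu produces a term in the second derivative of tau, which is
    symmetric and drops out after antisymmetrisation. *)
Lemma extd1_pullback m n (lam : 'rV[R]_m -> 'cV[R]_m) (mu : 'rV[R]_n -> 'cV[R]_n)
    (tau : 'rV[R]_m -> 'rV[R]_n) x u v :
  smooth_at lam x -> smooth_at mu (tau x) -> smooth_at tau x ->
  (\forall y \near x, forall w, ev1 (lam y) w = ev1 (mu (tau y)) (w *m 'J tau y)) ->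
  ev2 (extd1 lam x) u v = ev2 (extd1 mu (tau x)) (u *m 'J tau x) (v *m 'J tau x).
Proof.
move=> lx mx tx H.
have dmx := smooth_at_differentiable mx; have dtx := smooth_at_differentiable tx.
have mtx : smooth_at (fun y => mu (tau y)) x by exact: smooth_at_comp_mx.
have E a b : 'D_a (fun y => ev1 (lam y) b) x =
    ('D_a ('D_b tau) x *m mu (tau x)) 0 0 +
    ev2 ('J (fun y => (mu y)^T) (tau x)) (a *m 'J tau x) (b *m 'J tau x).
  have -> : 'D_a (fun y => ev1 (lam y) b) x = 'D_a (fun y => ('D_b tau y *m mu (tau y)) 0 0) x.
    apply: near_eq_derive; apply: filterS2 H (smooth_at_near tx) => y -> ty.
    by rewrite /ev1 deriveEjacobian//; exact: smooth_at_differentiable.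
  have sbt : smooth_at ('D_b tau) x by exact: smooth_at_derive.
  rewrite derive_coord; last by apply/smooth_at_differentiable/smooth_at_mulmx.
  have [_ ->] := differentiable_mulmx a (smooth_at_differentiable sbt)
     (smooth_at_differentiable mtx).
  rewrite mxE; congr (_ + _).
  have -> : 'D_a (fun y => mu (tau y)) x = 'D_(a *m 'J tau x) mu (tau x).
    rewrite (deriveE _ (smooth_at_differentiable mtx)) (deriveE _ dmx).
    rewrite -(deriveEjacobian _ dtx) (deriveE _ dtx).
    by have := congr1 (fun g => g a) (diff_comp dtx dmx).
  rewrite (deriveEjacobian b dtx) -(derive_ev1 _ _ mx).
  rewrite /ev1 derive_coord; last first.
    by apply/smooth_at_differentiable/smooth_at_mulmx => //; exact: smooth_at_cst.
  have [_ ->] := differentiable_mulmx (a *m 'J tau x)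
     (differentiable_cst (b *m 'J tau x) (tau x)) dmx.
  by rewrite derive_cst mul0mx add0r.
rewrite (ev2_extd1 _ _ lx) (ev2_extd1 _ _ mx) /ext_d1 (E u v) (E v u).
rewrite (derive_schwarz_mx u v tx) (derive_ev1 _ _ mx) (derive_ev1 _ _ mx); ring.
Qed.

Lemma derive_lsubmx W m n (g : 'rV[R]_m -> W) (Y u : 'rV[R]_(m + n)) :
  'D_u (fun y : 'rV[R]_(m + n) => g (lsubmx y)) Y = 'D_(lsubmx u) g (lsubmx Y).
Proof.
rewrite /derive.
suff -> : (fun h : R => h^-1 *: (((fun y : 'rV[R]_(m + n) => g (lsubmx y)) \o shift Y)
    (h *: u) - g (lsubmx Y))) =
  (fun h => h^-1 *: ((g \o shift (lsubmx Y)) (h *: lsubmx u) - g (lsubmx Y))) by [].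
apply/funext => h /=; congr (_ *: (g _ - _)).
by apply/matrixP => i j; rewrite !mxE.
Qed.

End ExteriorDerivative.

(** * Smooth bump functions *)

Section Bump.
Context {R : realType}.
Implicit Types V W : normedModType R.

(** Functions p(1/t) exp(-1/t), extended by zero to t <= 0.  Allowing any
    polynomial p makes the family stable under differentiation. *)
Definition flat (p : {poly R}) (t : R) : R :=
  if 0 < t then p.[t^-1] * expR (- t^-1) else 0.

(** From s ^ (k + 2) / (k + 2)! <= exp s for s > 0, applied to each monomial. *)
Lemma poly_expR_bound (p : {poly R}) :
  exists2 C : R, 0 <= C & forall s, 0 < s -> `|p.[s]| * expR (- s) <= C * s^-1 ^+ 2.
Proof.
have mono k s : 0 < s -> s ^+ k * expR (- s) <= (k.+2)`!%:R * s^-1 ^+ 2.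
  move=> s0; have s00 := ltW s0.
  have := expR_ge1Dxn k.+1 s00; rewrite expRN => H.
  have {}H : s ^+ k.+2 / (k.+2)`!%:R <= expR s by rewrite (le_trans _ H)// lerDr.
  rewrite ler_pdivrMr ?expR_gt0// exprVn mulrAC ler_pdivlMr ?exprn_gt0//.
  by rewrite -exprD addn2 mulrC -ler_pdivrMr// ltr0n fact_gt0.
exists (\sum_(i < size p) `|p`_i| * (i.+2)`!%:R).
  by apply: sumr_ge0 => i _; rewrite mulr_ge0.
move=> s s0; rewrite horner_coef mulr_suml.
apply: (@le_trans _ _ (\sum_(i < size p) `|p`_i| * (s ^+ i * expR (- s)))).
  under [leRHS]eq_bigr do rewrite mulrA.
  rewrite -mulr_suml ler_wpM2r ?expR_ge0// (le_trans (ler_norm_sum _ _ _))//.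
  by apply: ler_sum => i _; rewrite normrM normrX (gtr0_norm s0).
by apply: ler_sum => i _; rewrite -mulrA ler_wpM2l// mono.
Qed.

(** A quadratic bound gives differentiability at 0, with derivative 0. *)
Lemma flat_bound (p : {poly R}) :
  exists2 C : R, 0 <= C & forall t, `|flat p t| <= C * t ^+ 2.
Proof.
have [C C0 H] := poly_expR_bound p; exists C => // t; rewrite /flat.
case: ifPn => [t0|_]; last by rewrite normr0 mulr_ge0// sqr_ge0.
rewrite normrM (ger0_norm (expR_ge0 _)).
by have := H t^-1; rewrite invrK; apply; rewrite invr_gt0.
Qed.

Lemma is_derive_flat (p : {poly R}) (t : R) :
  is_derive t 1 (flat p) (flat ('X^2 * (p - p^`())) t).
Proof.
have [t0|t0|->] := ltgtP t 0.
- apply: (@near_eq_is_derive _ _ _ (fun=> 0)).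
    have := lt_nbhsl t0; apply: filterS => s s0.
    by rewrite /flat ltNge ltW.
  by rewrite /flat ltNge ltW//=; exact: is_derive_cst.
- apply: (@near_eq_is_derive R R R (fun t : R => p.[t^-1] * expR (- t^-1))).
    have := lt_nbhsr t0; apply: filterS => s s0.
    by rewrite /flat s0.
  rewrite /flat t0.
  have tn0 : t != 0 by rewrite gt_eqF.
  have dV := is_deriveV tn0 (is_derive_id t (1 : R)).
  have dN := is_deriveN dV.
  have d1 := is_derive1_comp (is_derive_poly p t^-1) dV.
  have d2 := @is_derive1_comp R expR (fun t => - t^-1) _ _ _ (is_derive_expR (- t^-1)) dN.
  apply: is_derive_eq (is_deriveM d1 d2) _.
  rewrite !hornerE /= /GRing.scale /= derivE derive1E.
  by rewrite -!exprVn; ring.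
- have [C C0 H] := flat_bound p.
  have E h : (flat p \o shift 0) (h *: (1 : R^o)) = flat p h by rewrite /= addr0 [h%:A]mulr1.
  have F0 q : flat q 0 = 0 by rewrite /flat ltxx.
  rewrite F0.
  have L : (fun h => h^-1 *: ((flat p \o shift 0) (h *: (1 : R^o)) - flat p 0)) @ 0^' --> (0 : R).
    apply/cvgrPdist_le => e e0; near=> h; rewrite E F0 subr0 sub0r normrN normrM normfV.
    have h0 : h != 0 by near: h; exact: nbhs_dnbhs_neq.
    rewrite ler_pdivrMl ?normr_gt0// (le_trans (H h))//.
    rewrite -[h ^+ 2]ger0_norm ?sqr_ge0// normrX expr2 mulrA [leRHS]mulrC ler_wpM2r//.
    have : `|h| <= e / (C + 1).
      by near: h; apply: dnbhs0_le; rewrite divr_gt0// ltr_wpDl.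
    rewrite ler_pdivlMr ?ltr_wpDl// => /(le_trans _); apply.
    by rewrite mulrDr mulr1 mulrC lerDl.
  split; first by apply/cvg_ex; exists 0; exact: L.
  exact: cvg_lim L.
Unshelve. all: by end_near. Qed.

Lemma Cn_flat r (p : {poly R}) : Cn r setT (flat p).
Proof.
elim: r p => [|r IH] p.
  move=> t _; apply/differentiable_continuous/derivable1_diffP.
  by case: (is_derive_flat p t).
split=> [t _|v]; first by apply/derivable1_diffP; case: (is_derive_flat p t).
rewrite (_ : (fun t => 'D_v _ t) = flat (v *: ('X^2 * (p - p^`())))).
  exact: IH.
apply/funext => t; have [dt E] := is_derive_flat p t.
move/derivable1_diffP in dt.
have -> : v = v *: (1 : R^o) by rewrite [v%:A]mulr1.
rewrite deriveE// linearZ -deriveE// E /flat.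
case: ifP => _; last exact: mulr0.
by rewrite [v *: (1 : R^o)]mulr1 hornerZ -mulrA.
Qed.

(** A smooth step: 1 for t <= 1 and 0 for t >= 2.  At every t one of the two
    summands of the denominator is positive. *)
Definition cutoff (t : R) : R := flat 1 (2 - t) / (flat 1 (2 - t) + flat 1 (t - 1)).

Lemma flat1_ge0 t : 0 <= flat 1 t.
Proof. by rewrite /flat; case: ifP => // _; rewrite hornerC mul1r expR_ge0. Qed.

Lemma flat1_gt0 t : 0 < t -> 0 < flat 1 t.
Proof. by rewrite /flat => ->; rewrite hornerC mul1r expR_gt0. Qed.

Lemma cutoff_den_gt0 t : 0 < flat 1 (2 - t) + flat 1 (t - 1).
Proof.
case: (ltP t 2) => t2.
  by rewrite ltr_pwDl ?flat1_ge0 ?flat1_gt0// subr_gt0.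
by rewrite ltr_wpDl ?flat1_ge0 ?flat1_gt0// subr_gt0 (lt_le_trans _ t2)// ltr1n.
Qed.

Lemma smooth_at_flat p t : smooth_at (flat p) t.
Proof. by exists setT => [|r]; [split=> //; exact: openT|exact: Cn_flat]. Qed.

Lemma cutoff_ge0 t : 0 <= cutoff t.
Proof. by rewrite divr_ge0 ?flat1_ge0// ltW// cutoff_den_gt0. Qed.

Lemma cutoff_le1 t : cutoff t <= 1.
Proof. by rewrite ler_pdivrMr ?cutoff_den_gt0// mul1r lerDl flat1_ge0. Qed.

Lemma cutoff1 t : t <= 1 -> cutoff t = 1.
Proof.
move=> t1; rewrite /cutoff {3}/flat ltNge subr_le0 t1 /= addr0 divff//.
by rewrite gt_eqF// flat1_gt0// subr_gt0 (le_lt_trans t1)// ltr1n.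
Qed.

Lemma cutoff0 t : 2 <= t -> cutoff t = 0.
Proof. by move=> t2; rewrite /cutoff {1}/flat ltNge subr_le0 t2 /= mul0r. Qed.

Lemma smooth_at_comp_cutoff V (f : V -> R) x :
  smooth_at f x -> smooth_at (fun y => cutoff (f y)) x.
Proof.
move=> fx.
have fl (g : V -> R) : smooth_at g x -> smooth_at (fun y => flat 1 (g y)) x.
  by move=> gx; exact: smooth_at_comp_R gx (smooth_at_flat _ _).
have s1 : smooth_at (fun y => flat 1 (2 - f y)) x.
  apply: fl; apply: smooth_atD; first exact: smooth_at_cst.
  have := smooth_atM (smooth_at_cst (-1 : R) x) fx.
  by under eq_fun do rewrite mulN1r.
apply: smooth_atM => //; apply: smooth_atV; last by rewrite gt_eqF// cutoff_den_gt0.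
by apply: smooth_atD => //; apply: fl; apply: smooth_atD => //; exact: smooth_at_cst.
Qed.

(** The Euclidean square norm is used because the sup norm of ['rV[R]_n] is not
    smooth. *)
Definition sqnorm n (x : 'rV[R]_n) : R := \sum_i x 0 i ^+ 2.

Lemma smooth_at_sqnorm n (x0 x : 'rV[R]_n) : smooth_at (fun y => sqnorm (y - x0)) x.
Proof.
apply: smooth_at_sum => i _; under eq_fun do rewrite expr2.
have s : smooth_at (fun y : 'rV[R]_n => (y - x0) 0 i) x.
  by apply/smooth_at_coord/smooth_atD; [exact: smooth_at_id|exact: smooth_at_cst].
exact: smooth_atM.
Qed.

Lemma sqnorm_ge0 n (x : 'rV[R]_n) : 0 <= sqnorm x.
Proof. by apply: sumr_ge0 => i _; exact: sqr_ge0. Qed.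

Lemma sqnorm0 n : sqnorm (0 : 'rV[R]_n) = 0.
Proof. by apply: big1 => i _; rewrite mxE expr0n. Qed.

Lemma norm_sqnorm n (x : 'rV[R]_n) (d : R) : 0 < d -> sqnorm x < d ^+ 2 -> `|x| < d.
Proof.
move=> d0 xd; rewrite [ltLHS]mx_normrE; apply: bigmax_lt => // -[i j] _ /=.
rewrite -(@ltr_pXn2r _ 2) ?nnegrE//; last exact: ltW.
rewrite real_normK ?num_real//.
apply: le_lt_trans xd; rewrite /sqnorm (bigD1 j)//= ord1 lerDl.
by apply: sumr_ge0 => k _; exact: sqr_ge0.
Qed.

Lemma exists_bump n (x0 : 'rV[R]_n) (U : set 'rV[R]_n) : open_nbhs x0 U ->
  exists b : 'rV[R]_n -> R, [/\ forall x, smooth_at b x, forall x, 0 <= b x <= 1,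
    exists2 W, open_nbhs x0 W /\ W `<=` U & forall x, W x -> b x = 1 &
    exists K, [/\ compact K, K `<=` U & forall x, ~ K x -> b x = 0]].
Proof.
move=> /open_nbhs_nbhs/nbhs_ballP[d /= d0 dU].
(* Then s x <= 2 forces sqnorm (x - x0) <= d ^ 2 / 2, hence x within d of x0. *)
pose e := d ^+ 2 / 4; have e0 : 0 < e by rewrite divr_gt0// exprn_gt0.
pose s x := e^-1 * sqnorm (x - x0).
have ss x : smooth_at s x.
  by apply: smooth_atM; [exact: smooth_at_cst|exact: smooth_at_sqnorm].
have cs : continuous s by move=> x; exact/smooth_at_continuous.
have sU x : s x <= 2 -> `|x - x0| < d.
  rewrite /s mulrC ler_pdivrMr// => h; apply: norm_sqnorm => //.
  by apply: le_lt_trans h _; rewrite /e; have := exprn_gt0 2 d0; lra.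
exists (cutoff \o s); split.
- by move=> x; apply: smooth_at_comp_cutoff.
- by move=> x; rewrite /= cutoff_ge0 cutoff_le1.
- exists (s @^-1` [set t | t < 1]) => [|x /= /ltW/cutoff1//].
  split; first split.
  + by apply: open_comp => // x _; exact: cs.
  + by rewrite /= /s subrr sqnorm0 mulr0.
  + move=> x /= s1; apply: dU; rewrite -ball_normE /= distrC sU//.
    by rewrite (le_trans (ltW s1))// ler1n.
- exists (s @^-1` [set t | t <= 2]); split.
  + apply: bounded_closed_compact; last first.
      by apply: closed_comp => // x _; exact: cs.
    exists (`|x0| + d); split; first exact: num_real.
    move=> M hM x /= /sU h; rewrite -(subrK x0 x).
    by rewrite (le_trans (ler_normD _ _))// (le_trans _ (ltW hM))// addrC lerD// ltW.
  + by move=> x /sU h; apply: dU; rewrite -ball_normE /= distrC.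
  + by move=> x /= /negP; rewrite -ltNge => /ltW/cutoff0.
Qed.

End Bump.

(** * Charts and their jacobians *)

Section Charts.
Context {R : realType}.

Section OneChart.
Variables (M : topologicalType) (n : nat) (a : chart R M n).

Lemma chart_imP p : chart_dom a p -> chart_im a (a p).
Proof. by move=> ap; exists p. Qed.

Lemma chart_im_inv x : chart_im a x -> chart_dom a (chart_inv a x) /\ a (chart_inv a x) = x.
Proof. by move=> [p ap <-]; rewrite chart_mapK. Qed.

Lemma near_chart_inv p (P : set M) : chart_dom a p -> nbhs p P ->
  \forall x \near a p, P (chart_inv a x).
Proof.
move=> ap Pp; have := @chart_inv_continuous _ _ _ a (a p) (chart_imP ap).
rewrite /prop_for /= /continuous_at chart_mapK// => cinv; exact: (cinv P Pp).
Qed.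

Lemma near_chart_im p : chart_dom a p -> \forall x \near a p, chart_im a x.
Proof. by move=> ap; apply: open_nbhs_nbhs; split; [exact: chart_im_open|exact: chart_imP]. Qed.

Lemma near_chart_map p (P : set 'rV[R]_n) : chart_dom a p -> nbhs (a p) P ->
  \forall q \near p, P (a q).
Proof. by move=> ap Pp; exact: (@chart_map_continuous _ _ _ a p ap P Pp). Qed.

Lemma chart_image_open (O : set M) : open O -> open (a @` (chart_dom a `&` O)).
Proof.
move=> oO; have -> : a @` (chart_dom a `&` O) =
    chart_im a `&` (chart_inv a @^-1` O).
  apply/seteqP; split=> [_ [p [ap Op] <-]|x [ax Ox]].
    by split; [exact: chart_imP|rewrite /= chart_mapK].
  by have [dx xE] := chart_im_inv ax; exists (chart_inv a x).
rewrite openE => x [ax Ox]; rewrite /interior.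
have [dx xE] := chart_im_inv ax.
have h1 := near_chart_im dx; rewrite xE in h1.
have h2 := near_chart_inv dx (open_nbhs_nbhs (conj oO Ox)); rewrite xE in h2.
exact: filterI h1 h2.
Qed.

End OneChart.

Variables (n : nat) (M : manifold R n).
Implicit Types (a b c : atlas_index M) (p q : M).

Notation dom a := (chart_dom (atlas a)).
Notation inv a := (chart_inv (atlas a)).

(** The change of components of tangent vectors at p.  It is indexed by points of
    M instead of coordinates, which turns the chain rule into the cocycle
    identity [JacM]. *)
Definition Jac a b p : 'M[R]_n := 'J (transition (atlas a) (atlas b)) (atlas a p).

Lemma transitionE a b p : dom a p -> transition (atlas a) (atlas b) (atlas a p) = atlas b p.
Proof. by move=> ap; rewrite /transition /local_expr chart_mapK. Qed.

Lemma smooth_at_transition a b p : dom a p -> dom b p ->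
  smooth_at (transition (atlas a) (atlas b)) (atlas a p).
Proof.
move=> ap bp; have [H _] := atlas_compatible a b.
apply: smooth_onW H _; last by exists p.
by apply: chart_image_open; exact: chart_dom_open.
Qed.

Lemma diff_transition a b p v : dom a p -> dom b p ->
  'd (transition (atlas a) (atlas b)) (atlas a p) v = v *m Jac a b p.
Proof. by move=> ap bp; rewrite /Jac /jacobian mul_rV_lin1. Qed.

Lemma near_dom a p : dom a p -> \forall q \near p, dom a q.
Proof. by move=> ap; apply: open_nbhs_nbhs; split => //; exact: chart_dom_open. Qed.

Lemma JacM a b c p : dom a p -> dom b p -> dom c p ->
  Jac a b p *m Jac b c p = Jac a c p.
Proof.
move=> ap bp cp; rewrite /Jac.
have tab := smooth_at_transition ap bp.
have tbc := smooth_at_transition bp cp; rewrite -(transitionE b ap) in tbc *.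
rewrite -jacobian_comp; try exact: smooth_at_differentiable.
apply: near_eq_jacobian; last first.
  by apply: differentiable_comp; exact: smooth_at_differentiable.
have := near_chart_inv ap (near_dom bp); have := near_chart_im ap.
move=> h1 h2; apply: filterS2 h1 h2 => x ax bx /=.
have [dx xE] := chart_im_inv ax.
by rewrite /transition /local_expr /= chart_mapK.
Qed.

Lemma Jac1 a p : dom a p -> Jac a a p = 1%:M.
Proof.
move=> ap; rewrite /Jac.
have <- : 'J (id : 'rV[R]_n -> 'rV[R]_n) (atlas a p) = 1%:M.
  have did : differentiable (id : 'rV[R]_n -> 'rV[R]_n) (atlas a p).
    exact/smooth_at_differentiable/smooth_at_id.
  apply/row_matrixP => i; rewrite !rowE mulmx1 -(deriveEjacobian _ did).
  exact: derive_id.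
apply/esym/near_eq_jacobian; last exact/smooth_at_differentiable/smooth_at_id.
apply: filterS (near_chart_im ap) => x ax.
by have [_ xE] := chart_im_inv ax; rewrite /transition /local_expr xE.
Qed.

Lemma Jac_unit a b p : dom a p -> dom b p -> Jac a b p \in unitmx.
Proof.
move=> ap bp; have [+ _] := mulmx1_unit (etrans (JacM ap bp ap) (Jac1 ap)).
exact.
Qed.

Lemma smooth_at_Jac a b p : dom a p -> dom b p ->
  smooth_at (fun x => Jac a b (inv a x)) (atlas a p).
Proof.
move=> ap bp; apply: smooth_at_eq (smooth_at_jacobian (smooth_at_transition ap bp)).
apply: filterS (near_chart_im ap) => x ax.
by have [_ xE] := chart_im_inv ax; rewrite /Jac xE.
Qed.

Lemma smooth_at_chart (p' q' : nat) (f : M -> 'M[R]_(p', q')) a b p :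
  dom a p -> dom b p ->
  smooth_at (fun x => f (inv a x)) (atlas a p) -> smooth_at (fun x => f (inv b x)) (atlas b p).
Proof.
move=> ap bp fa.
have tba := smooth_at_transition bp ap; rewrite -(transitionE a bp) in fa.
apply: smooth_at_eq (smooth_at_comp_mx tba fa).
apply: filterS (near_chart_inv bp (near_dom ap)) => x ax.
by rewrite /transition /local_expr chart_mapK.
Qed.

End Charts.

(** * Locally finite families of bump functions *)

(** For each basic open set contained in some W p, one such p is kept. *)
Lemma lindelof (T : topologicalType) (W : T -> set T) :
  @second_countable T -> (forall p, open_nbhs p (W p)) ->
  exists s : nat -> option T, forall q, exists i p, s i = Some p /\ W p q.
Proof.
move=> [B /countable_injP[f finj] [Bo Bb]] HW.
pose P i p := exists U, [/\ B U, f U = i & U `<=` W p].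
pose s i := if pselect (exists p, P i p) is left e then Some (projT1 (cid e)) else None.
exists s => q.
have [U [BU Uq] UW] := Bb q (W q) (open_nbhs_nbhs (HW q)).
exists (f U); rewrite /s; case: pselect => [e|]; last by case; exists q, U.
case: cid => p [U' [BU' fU' U'W]] /=; exists p; split => //.
have UU : U' = U by apply: finj; rewrite ?inE.
by apply: U'W; rewrite UU.
Qed.

Lemma ev2_mxtr {R : realType} m n (A : 'M[R]_(m, n)) (v : 'rV[R]_m) :
  ev2 (A *m A^T) v v = sqnorm (v *m A).
Proof.
rewrite /ev2 !mulmxA -mulmxA -trmx_mul mxE /sqnorm.
by apply: eq_bigr => i _; rewrite [X in _ * X]mxE.
Qed.

Lemma sqnorm_eq0 {R : realType} n (x : 'rV[R]_n) : sqnorm x = 0 -> x = 0.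
Proof.
move=> /eqP; rewrite psumr_eq0 => [/allP x0|i _]; last exact: sqr_ge0.
apply/rowP => i; rewrite [RHS]mxE; apply/eqP; rewrite -sqrf_eq0.
by apply: (implyP (x0 i _)) => //; rewrite mem_index_enum.
Qed.

Section Metric.
Context {R : realType} {n : nat}.
Variable M : manifold R n.
Notation dom a := (chart_dom (atlas (m := M) a)).
Notation inv a := (chart_inv (atlas (m := M) a)).

Definition smooth_fun (f : M -> R) := forall b q, dom b q ->
  smooth_at (fun x => f (inv b x)) (atlas b q).

Lemma smooth_at_fun_near0 (V : normedModType R) (b : atlas_index M) q (f : M -> V) : dom b q ->
  (\forall p \near q, f p = 0) -> smooth_at (fun x => f (inv b x)) (atlas b q).
Proof.
move=> bq f0; apply: (@smooth_at_eq _ _ _ (fun=> 0)); last exact: smooth_at_cst.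
by apply: filterS (near_chart_inv bq f0) => x ->.
Qed.

(** A bump function of the chart is extended by zero.  Smoothness outside the chart
    needs the support to be closed in M: it is compact, being the image of a
    compact set, and M is Hausdorff. *)
Lemma manifold_bump p : exists (f : M -> R) (a : atlas_index M),
  [/\ smooth_fun f, forall q, 0 <= f q <= 1,
      exists2 W, open_nbhs p W & forall q, W q -> f q = 1 &
      forall q, dom a q \/ \forall q' \near q, f q' = 0].
Proof.
have [a ap] := atlas_cover p.
have oim : open_nbhs (atlas a p) (chart_im (atlas a)).
  by split; [exact: chart_im_open|exact: chart_imP].
have [b [bs b01 [W [[oW Wp] WU] W1] [K [cK KU K0]]]] := exists_bump oim.
pose f q := if pselect (dom a q) then b (atlas a q) else 0.
pose KM := inv a @` K.
have cKM : closed KM.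
  apply: compact_closed; first exact: manifold_hausdorff.
  apply: continuous_compact => //; apply: continuous_in_subspaceT => x /set_mem /KU.
  exact: chart_inv_continuous.
have f0 q : ~ KM q -> f q = 0.
  move=> nKM; rewrite /f; case: pselect => // aq; apply: K0 => KK; apply: nKM.
  by exists (atlas a q) => //; rewrite chart_mapK.
have KMa q : KM q -> dom a q.
  by move=> [x /KU ax <-]; have [] := chart_im_inv ax.
have dich q : dom a q \/ \forall q' \near q, f q' = 0.
  have [aq|naq] := pselect (dom a q); [by left|right].
  have : open_nbhs q (~` KM) by split; [exact: closed_openC|move=> /KMa].
  by move=> /open_nbhs_nbhs; apply: filterS => q'; exact: f0.
exists f, a; split => //.
- move=> c q cq; have [aq|f0q] := dich q; last exact: smooth_at_fun_near0.
  have tca := smooth_at_transition cq aq.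
  apply: smooth_at_eq (smooth_at_comp tca (bs _)).
  have := near_chart_inv cq (near_dom aq); apply: filterS => x ax.
  by rewrite /f; case: pselect.
- by move=> q; rewrite /f; case: pselect => aq; [exact: b01|rewrite lexx ler01].
- exists [set q | dom a q /\ W (atlas a q)] => [|q [aq /W1 <-]]; last first.
    by rewrite /f; case: pselect.
  split=> //; rewrite openE => q [aq Wq].
  exact: filterI (near_dom aq) (near_chart_map aq (open_nbhs_nbhs (conj oW Wq))).
Qed.

(** Let phi_i be countably many bump functions such that each point has a
    neighbourhood on which one of them equals 1, and let
    rho_i = phi_i * prod_(j < i) (1 - phi_j).  Where phi_m = 1, all rho_i with
    i > m vanish, so the family is locally finite without any appeal to
    paracompactness.  The function rho_i is positive at q when i is the
    least index with phi_i(q) = 1.  [N q] bounds the indices that matter near q. *)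
Lemma manifold_partition : exists (rho : nat -> M -> R) (c : nat -> option (atlas_index M))
    (N : M -> nat),
  [/\ forall i, smooth_fun (rho i) /\ forall q, 0 <= rho i q,
      forall q, exists2 i, (i < N q)%N & 0 < rho i q,
      forall q, \forall q' \near q, forall i, (N q <= i)%N -> rho i q' = 0 &
      forall i q, (exists2 a, c i = Some a & dom a q) \/ \forall q' \near q, rho i q' = 0].
Proof.
have /choice[f /choice[a fa]] := manifold_bump.
have /choice[W HW] : forall p, exists W, open_nbhs p W /\ forall q, W q -> f p q = 1.
  by move=> p; have [_ _ [W ? ?] _] := fa p; exists W.
have [s Hs] := lindelof (@manifold_second_countable _ _ M) (fun p => (HW p).1).
pose phi i q := if s i is Some p then f p q else 0.
pose c i := if s i is Some p then Some (a p) else None.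
have /choice[N HN] : forall q, exists i, (exists p, s i = Some p /\ W p q).
  by move=> q; have [i [p ?]] := Hs q; exists i, p.
have phis i : smooth_fun (phi i).
  move=> b q bq; rewrite /phi; case: (s i) => [p|]; last exact: smooth_at_cst.
  by have [+ _ _ _] := fa p; apply.
have phi01 i q : 0 <= phi i q <= 1.
  rewrite /phi; case: (s i) => [p|]; last by rewrite lexx ler01.
  by have [_ + _ _] := fa p; apply.
have near1 q : \forall q' \near q, phi (N q) q' = 1.
  have [p [sp Wq]] := HN q; have [[oW _] W1] := HW p.
  apply: filterS (open_nbhs_nbhs (conj oW Wq)) => q' /W1 <-.
  by rewrite /phi sp.
pose rho i q := phi i q * \prod_(j < i) (1 - phi j q).
have rho0 i q : phi (N q) q = 1 -> (N q < i)%N -> rho i q = 0.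
  by move=> p1 Ni; rewrite /rho (bigD1 (Ordinal Ni))//= p1 subrr mul0r mulr0.
exists rho, c, (fun q => (N q).+1); split.
- move=> i; split=> [b q bq|q].
    apply: smooth_atM; first exact: phis.
    apply: smooth_at_prod => j _; apply: smooth_atD; first exact: smooth_at_cst.
    have := smooth_atM (smooth_at_cst (-1 : R) (atlas b q)) (phis j b q bq).
    by under eq_fun do rewrite mulN1r.
  have [p0 _] := andP (phi01 i q).
  by rewrite mulr_ge0// prodr_ge0// => j _; rewrite subr_ge0; have [] := andP (phi01 j q).
- move=> q; have ex : exists i, phi i q == 1.
    by exists (N q); apply/eqP; exact: nbhs_singleton (near1 q).
  case: (ex_minnP ex) => i /eqP i1 imin; exists i.
    by rewrite ltnS; apply: imin; apply/eqP; exact: nbhs_singleton (near1 q).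
  rewrite /rho i1 mul1r prodr_gt0// => j _; rewrite subr_gt0 lt_neqAle.
  have [_ ->] := andP (phi01 j q); rewrite andbT.
  by apply/negP => /imin; rewrite leqNgt ltn_ord.
- move=> q; apply: filterS (near1 q) => q' q1 i Ni.
  by rewrite /rho (bigD1 (Ordinal Ni))//= q1 subrr mul0r mulr0.
- move=> i q; rewrite /c /rho /phi; case: (s i) => [p|]; last first.
    by right; apply: nearW => q'; rewrite mul0r.
  have [_ _ _ /(_ q)[aq|q0]] := fa p; first by left; exists (a p).
  by right; apply: filterS q0 => q' ->; rewrite mul0r.
Qed.

(** * Riemannian metrics *)

(** The sum of the rho_i times the Euclidean metrics of the charts that carry them. *)
Lemma riemannian_metric : exists G : atlas_index M -> M -> 'M[R]_n,
  [/\ forall a p, dom a p -> smooth_at (fun x => G a (inv a x)) (atlas a p),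
      forall a b p, dom a p -> dom b p -> G a p = Jac a b p *m G b p *m (Jac a b p)^T &
      forall a p v, dom a p -> ev2 (G a p) v v = 0 -> v = 0].
Proof.
have [rho [c [N [rhoP rho_gt0 rho_fin rho_c]]]] := manifold_partition.
pose g i a p := rho i p *: (if c i is Some b then Jac a b p *m (Jac a b p)^T else 0 : 'M[R]_n).
pose G a p := \sum_(i < N p) g i a p.
have gs i a p : dom a p -> smooth_at (fun x => g i a (inv a x)) (atlas a p).
  move=> ap; case: (rho_c i p) => [[b cb bp]|r0]; last first.
    apply: smooth_at_fun_near0 => //; apply: filterS r0 => q; rewrite /g => ->.
    exact: scale0r.
  rewrite /g cb; apply: smooth_at_scalemx; first by have [+ _] := rhoP i; apply.
  by apply: smooth_at_mulmx; [|apply: smooth_at_trmx]; exact: smooth_at_Jac.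
exists G; split.
- move=> a p ap.
  apply: (@smooth_at_eq _ _ _ (fun x => \sum_(i < N p) g i a (inv a x))); last first.
    by apply: smooth_at_sum => i _; exact: gs.
  apply: filterS (near_chart_inv ap (rho_fin p)) => x; set q := inv a x => qp.
  have qq := nbhs_singleton (rho_fin q).
  (* Both N p and N q bound the nonzero terms at q, so the two partial sums agree. *)
  have trunc m m' : (forall i, (m <= i)%N -> rho i q = 0) ->
      \sum_(i < m) g i a q = \sum_(i < m + m') g i a q.
    move=> m0; rewrite big_split_ord /= [X in _ + X]big1 ?addr0// => i _.
    by rewrite /g m0 ?scale0r// leq_addr.
  by rewrite (trunc _ (N q) qp) /G (trunc _ (N p) qq) addnC.
- move=> a b p ap bp; rewrite /G mulmx_sumr mulmx_suml; apply: eq_bigr => i _.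
  rewrite /g -[X in _ = X *m _](scalemxAr (rho i p)) -[RHS](scalemxAl (rho i p)).
  case: (rho_c i p) => [[d cd dp]|/nbhs_singleton ->]; last by rewrite !scale0r.
  by rewrite cd -(JacM ap bp dp) trmx_mul !mulmxA.
- move=> a p v ap.
  have ev i : ev2 (g i a p) v v =
      rho i p * (if c i is Some b then sqnorm (v *m Jac a b p) else 0).
    rewrite /g; case: (c i) => [b|].
      by rewrite -ev2_mxtr /ev2 -(scalemxAr (rho i p)) -(scalemxAl (rho i p)) [LHS]mxE.
    by rewrite /ev2 scaler0 mulmx0 mul0mx mxE mulr0.
  have -> : ev2 (G a p) v v = \sum_(i < N p) ev2 (g i a p) v v.
    by rewrite /ev2 /G mulmx_sumr mulmx_suml summxE.
  move=> /eqP; rewrite psumr_eq0 => [/allP H|i _]; last first.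
    rewrite ev mulr_ge0//; first by have [_] := rhoP i; apply.
    by case: (c i) => // b; exact: sqnorm_ge0.
  have [i Ni ri] := rho_gt0 p.
  have := H (Ordinal Ni) (mem_index_enum _); rewrite /= ev.
  case: (rho_c i p) => [[b cb bp]|/nbhs_singleton r0]; last by rewrite r0 ltxx in ri.
  rewrite cb mulf_eq0 gt_eqF//= => /eqP/sqnorm_eq0 vJ.
  by rewrite -(mulmxK (Jac_unit ap bp) v) vJ mul0mx.
Qed.

End Metric.

(** * Gluing a manifold from charts *)

Section RowBase.
Context {R : realType}.

Lemma rV_countable_base m : exists B : nat -> set 'rV[R]_m,
  (forall k, open (B k)) /\
  forall x U, nbhs x U -> exists k, B k x /\ B k `<=` U.
Proof.
pose b (ck : 'rV[rat]_m * nat) : set 'rV[R]_m :=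
  ball (\row_j ratr (ck.1 0 j) : 'rV[R]_m) ck.2.+1%:R^-1.
pose B k := if unpickle k is Some ck then b ck else set0.
exists B; split.
  move=> k; rewrite /B; case: unpickle => [ck|]; last exact: open0.
  exact: ball_open.
move=> x U /nbhs_ballP[e /= e0 eU].
have [k ke] : exists k, k.+1%:R^-1 < e / 2.
  have e20 : 0 < e / 2 by rewrite divr_gt0.
  by have [k] := ltr_add_invr e20; rewrite add0r; exists k.
pose d : R := k.+1%:R^-1; have d0 : 0 < d by rewrite invr_gt0.
have /choice[c Hc] : forall j, exists c : rat, `|x 0 j - ratr c| < d.
  move=> j; have [|c] := @rat_in_itvoo R (x 0 j - d) (x 0 j + d).
    by rewrite ltrD2l gtrN.
  by rewrite in_itv /= => cx; exists c; rewrite distrC ltr_distl.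
exists (pickle ((\row_j c j : 'rV[rat]_m), k)).
rewrite /B pickleK /b /=; set y := \row_j _.
have xy : ball y d x.
  rewrite -ball_normE /= distrC [ltLHS]mx_normrE; apply: bigmax_lt => // -[i j] _.
  by rewrite /= ord1 !mxE.
split=> // z yz; apply: eU; rewrite -ball_normE /= (splitr e).
rewrite -(subrKA y x (- z)); apply: le_lt_trans (ler_normD _ _) _.
rewrite -ball_normE /= in yz; rewrite -ball_normE /= distrC in xy.
by apply: ltrD; [exact: lt_trans xy ke|exact: lt_trans yz ke].
Qed.

End RowBase.

(** Charts on a mere set: the transition maps are smooth and their domains open.
    The topology is recovered from the charts. *)
Record chart_data (R : realType) (m : nat) := ChartData {
  cd_carrier : choiceType;
  cd_index : Type;
  cd_dom : cd_index -> set cd_carrier;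
  cd_map : cd_index -> cd_carrier -> 'rV[R]_m;
  cd_inv : cd_index -> 'rV[R]_m -> cd_carrier;
  cd_cover : forall t, exists i, cd_dom i t;
  cd_mapK : forall i t, cd_dom i t -> cd_inv i (cd_map i t) = t;
  cd_open : forall i j, open (cd_map i @` (cd_dom i `&` cd_dom j));
  cd_smooth : forall i j,
    smooth_on (cd_map i @` (cd_dom i `&` cd_dom j)) (fun x => cd_map j (cd_inv i x)) }.

(** An alias of the underlying set, which carries no topology of its own (or a
    different one). *)
Definition glued (R : realType) (m : nat) (d : chart_data R m) : Type := cd_carrier d.
HB.instance Definition _ (R : realType) (m : nat) (d : chart_data R m) :=
  Choice.on (glued d).

Section Glue.
Context {R : realType} {m : nat}.
Variable d : chart_data R m.
Notation D := (cd_dom (c := d)).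
Notation phi := (cd_map (c := d)).
Notation psi := (cd_inv (c := d)).

Definition glued_open (A : set (glued d)) : Prop :=
  forall i, open (phi i @` (D i `&` A)).

Lemma glued_openT : glued_open setT.
Proof. by move=> i; rewrite setIT -(setIid (D i)); exact: cd_open. Qed.

Lemma glued_openI : setI_closed glued_open.
Proof.
move=> A B oA oB i.
suff -> : phi i @` (D i `&` (A `&` B)) = phi i @` (D i `&` A) `&` phi i @` (D i `&` B).
  exact: openI.
apply/seteqP; split=> [_ [t [Dt [At Bt]] <-]|_ [[t [Dt At] <-] [t' [Dt' Bt'] E]]].
  by split; exists t.
have tt : t' = t by rewrite -(cd_mapK Dt) -(cd_mapK Dt') E.
by exists t => //; split => //; split=> //; rewrite -tt.
Qed.

Lemma glued_open_bigU (I : Type) (f : I -> set (glued d)) :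
  (forall i, glued_open (f i)) -> glued_open (\bigcup_i f i).
Proof.
move=> of_ i; suff -> : phi i @` (D i `&` \bigcup_k f k) = \bigcup_k (phi i @` (D i `&` f k)).
  by apply: bigcup_open => k _; exact: of_.
apply/seteqP; split=> [_ [t [Dt [k _ kt]] <-]|_ [k _ [t [Dt kt] <-]]].
  by exists k => //; exists t.
by exists t => //; split => //; exists k.
Qed.

HB.instance Definition _ := isOpenTopological.Build (glued d)
  glued_openT glued_openI glued_open_bigU.

Lemma glued_dom_open i : open (D i : set (glued d)).
Proof. by move=> j; exact: cd_open. Qed.

Lemma glued_im_open i : open (phi i @` D i).
Proof. by rewrite -(setIid (D i)); exact: cd_open. Qed.

Lemma glued_map_continuous i (t : glued d) : D i t -> {for t, continuous (phi i : glued d -> _)}.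
Proof.
move=> Dt B; rewrite nbhsE => -[B' [oB' B't] B'B].
rewrite nbhs_simpl /= nbhsE; exists (D i `&` phi i @^-1` B'); last by move=> s [_ /B'B].
split; last by split.
move=> j.
have -> : phi j @` (D j `&` (D i `&` phi i @^-1` B')) =
    phi j @` (D j `&` D i) `&` (fun x => phi i (psi j x)) @^-1` B'.
  apply/seteqP; split=> [_ [s [Ds [Ds' Bs]] <-]|_ [[s [Ds Ds'] <-]]].
    by split; [exists s|rewrite /= cd_mapK].
  by rewrite /= cd_mapK// => Bs; exists s.
rewrite openE => x [xD xB]; rewrite /interior.
apply: filterI; first by apply: open_nbhs_nbhs; split => //; exact: cd_open.
have cji := @cd_smooth _ _ d j i 0 x xD.
by apply: cji; exact: open_nbhs_nbhs.
Qed.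

Lemma glued_inv_continuous i x : (phi i @` D i) x -> {for x, continuous (psi i : _ -> glued d)}.
Proof.
move=> [t Dt <-] A; rewrite /= cd_mapK// nbhsE => -[A' [oA' A't] A'A].
rewrite nbhs_simpl /= nbhsE; exists (phi i @` (D i `&` A')).
  by split; [exact: oA'|exists t].
by move=> _ [s [Ds As] <-] /=; rewrite cd_mapK//; exact: A'A.
Qed.

Definition glued_chart i : chart R (glued d) m :=
  @Chart R (glued d) m (D i) (phi i) (psi i)
    (@glued_dom_open i) (@glued_im_open i) (@cd_mapK _ _ d i)
    (@glued_map_continuous i) (@glued_inv_continuous i).

Lemma glued_compatible i j : compatible (glued_chart i) (glued_chart j).
Proof.
split; first exact: (cd_smooth (c := d) i j).
by rewrite /= setIC; exact: (cd_smooth (c := d) j i).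
Qed.

Lemma glued_continuous (B : topologicalType) (pi : glued d -> B) :
  (forall i x, (phi i @` D i) x -> {for x, continuous (pi \o psi i)}) -> continuous pi.
Proof.
move=> cpi t; have [i Dt] := cd_cover t.
have imt : (phi i @` D i) (phi i t) by exists t.
move=> X Xt; have := cpi i _ imt X; rewrite /= cd_mapK// => /(_ Xt) Xi.
have oD : open_nbhs t (D i : set (glued d)) by split=> //; exact: glued_dom_open.
have Xt' := glued_map_continuous Dt Xi.
have : nbhs t ((phi i : glued d -> _) @^-1` ((pi \o psi i) @^-1` X) `&` D i).
  by apply: filterI => //; exact: open_nbhs_nbhs.
by apply: filterS => s [/=]; move=> /[swap] Ds; rewrite cd_mapK.
Qed.

(** Two points that cannot be separated have the same image in B, hence lie in a
    common chart, where they are separated by their coordinates. *)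
Lemma glued_hausdorff (B : topologicalType) (pi : glued d -> B) :
  hausdorff_space B ->
  (forall i x, (phi i @` D i) x -> {for x, continuous (pi \o psi i)}) ->
  (forall s t, pi s = pi t -> exists i, D i s /\ D i t) ->
  hausdorff_space (glued d).
Proof.
move=> hB cpi fib s t st.
have cp := glued_continuous cpi.
have /fib[i [Ds Dt]] : pi s = pi t.
  apply: hB => X Y Xs Yt.
  by have [u [uX uY]] := st _ _ (cp s X Xs) (cp t Y Yt); exists (pi u).
rewrite -(cd_mapK Ds) -(cd_mapK Dt); congr (psi i).
apply: norm_hausdorff => X Y Xs Yt.
have [u [uX uY]] := st _ _ (glued_map_continuous Ds Xs) (glued_map_continuous Dt Yt).
by exists (phi i u).
Qed.

Lemma glued_second_countable (s : nat -> option (cd_index d)) :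
  (forall t, exists k i, s k = Some i /\ D i t) -> @second_countable (glued d).
Proof.
move=> cov; have [B [oB Bb]] := @rV_countable_base R m.
pose C (kl : nat * nat) : set (glued d) :=
  if s kl.1 is Some i then D i `&` phi i @^-1` (B kl.2) else set0.
have oC kl : open (C kl).
  rewrite /C; case: (s kl.1) => [i|]; last exact: open0.
  rewrite openE => t [Dt Bt]; rewrite /interior; apply: filterI.
    by apply: open_nbhs_nbhs; split=> //; exact: glued_dom_open.
  by apply: (glued_map_continuous Dt); apply: open_nbhs_nbhs.
exists (range C).
  exact: (sub_countable (card_image_le _ _) (countableP _)).
split=> [_ [kl _ <-]//|t A At].
have [k [i [ki Dt]]] := cov t.
have Ai : nbhs (phi i t) (psi i @^-1` A `&` phi i @` D i).
  apply: filterI.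
    have imt : (phi i @` D i) (phi i t) by exists t.
    by have := glued_inv_continuous imt; apply; rewrite cd_mapK.
  by apply: open_nbhs_nbhs; split; [exact: glued_im_open|exists t].
have [l [Bl BlA]] := Bb _ _ Ai.
exists (C (k, l)); first by split; [exists (k, l)|rewrite /C /= ki].
rewrite /C /= ki => u [Du /BlA[Au _]].
by rewrite /= cd_mapK in Au.
Qed.

Section Manifold.
Hypotheses (hd : hausdorff_space (glued d)) (sc : @second_countable (glued d)).

Definition glued_manifold : manifold R m :=
  @Manifold R m (glued d) (cd_index d) glued_chart hd sc
    (@cd_cover _ _ d) glued_compatible.

End Manifold.
End Glue.

(** * The characteristic bundle and its cocycle *)

Section Frames.
Context {R : realType} {n k : nat}.
Variables (M : k_precosymplectic R n k) (r : nat).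
Hypothesis Vsmooth : smooth_distribution (char_distribution M) r.

Notation dom a := (chart_dom (atlas a)).
Notation inv a := (chart_inv (atlas a)).

Record frame := Frame {
  fr_chart : atlas_index M;
  fr_im : set 'rV[R]_n;
  fr_mx : 'rV[R]_n -> 'M[R]_(r, n);
  fr_open : open fr_im;
  fr_sub : fr_im `<=` chart_im (atlas fr_chart);
  fr_smooth : smooth_on fr_im fr_mx;
  fr_span : forall q : M, dom fr_chart q -> fr_im (atlas fr_chart q) ->
    row_free (fr_mx (atlas fr_chart q)) /\
    forall v : 'rV[R]_n, char_distribution M fr_chart q v <->
      (v <= fr_mx (atlas fr_chart q))%MS }.

Implicit Types (i j l : frame) (q : M).
Notation chi j := (atlas (fr_chart j)).

Definition fr_dom j : set M := [set q | dom (fr_chart j) q /\ fr_im j (chi j q)].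

Lemma exists_frame q : exists j, fr_dom j q.
Proof.
have [a aq] := atlas_cover q.
by have [U [F [oU Uq Uim sF HF]]] := Vsmooth aq; exists (Frame oU Uim sF HF).
Qed.

Lemma fr_dom_open j : open (fr_dom j).
Proof.
rewrite openE => q [dq Uq].
exact: filterI (near_dom dq) (near_chart_map dq (open_nbhs_nbhs (conj (@fr_open j) Uq))).
Qed.

Lemma fr_dom_inv j x : fr_im j x -> fr_dom j (inv (fr_chart j) x) /\ chi j (inv (fr_chart j) x) = x.
Proof.
move=> jx; have [dx E] := chart_im_inv (@fr_sub j x jx).
by split=> //; split=> //; rewrite E.
Qed.

Lemma smooth_at_fr j x : fr_im j x -> smooth_at (fr_mx j) x.
Proof. by move=> jx; apply: smooth_onW jx; [exact: fr_open|exact: fr_smooth]. Qed.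

Definition fr_row j q : 'M[R]_(r, n) := fr_mx j (chi j q).

(** A right inverse of the matrix of the frame that depends smoothly on the point:
    the Gram matrix is invertible since the rows are independent. *)
Definition fr_pinv j q : 'M[R]_(n, r) :=
  (fr_row j q)^T *m invmx (fr_row j q *m (fr_row j q)^T).

(** If v A A^T = 0 then |v A|^2 = 0. *)
Lemma gram_unit m p (A : 'M[R]_(m, p)) : row_free A -> A *m A^T \in unitmx.
Proof.
move=> fA; rewrite -row_free_unit; apply: inj_row_free => v vA.
have : ev2 (A *m A^T) v v = 0 by rewrite /ev2 vA mul0mx mxE.
rewrite ev2_mxtr => /sqnorm_eq0 vA0.
by apply: (row_free_inj fA); rewrite vA0 mul0mx.
Qed.

Lemma fr_free j q : fr_dom j q -> row_free (fr_row j q).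
Proof. by move=> [dq Uq]; have [] := fr_span dq Uq. Qed.

Lemma fr_char j q v : fr_dom j q -> char_distribution M (fr_chart j) q v <-> (v <= fr_row j q)%MS.
Proof. by move=> [dq Uq]; have [_] := fr_span dq Uq. Qed.

Lemma fr_rowK j q : fr_dom j q -> fr_row j q *m fr_pinv j q = 1%:M.
Proof.
move=> jq; apply: etrans (mulmxA _ _ _) _.
by apply: mulmxV; apply: gram_unit; exact: fr_free.
Qed.

(** The forms transform by the jacobian, so their common kernel does too. *)
Lemma char_distribution_Jac a b q v : dom a q -> dom b q ->
  char_distribution M a q v -> char_distribution M b q (v *m Jac a b q).
Proof.
move=> aq bq [v1 v2]; split=> [i|i w].
  by rewrite -diff_transition// -form1_transition.
have JJ : Jac b a q *m Jac a b q = 1%:M by rewrite (JacM bq aq bq) (Jac1 bq).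
rewrite -(mulmx1 w) -JJ mulmxA -!diff_transition// -form2_transition//.
Qed.

(** The matrix C such that a vector with components xi in the frame i has components
    xi C in the frame j. *)
Definition cocycle i j q : 'M[R]_r :=
  fr_row i q *m Jac (fr_chart i) (fr_chart j) q *m fr_pinv j q.

(** The rows on the right are vectors of V at q, hence combinations of the rows of
    the frame j; on such combinations the right inverse of the frame is a genuine
    inverse. *)
Lemma cocycle_row i j q : fr_dom i q -> fr_dom j q ->
  cocycle i j q *m fr_row j q = fr_row i q *m Jac (fr_chart i) (fr_chart j) q.
Proof.
move=> iq jq.
have : (fr_row i q *m Jac (fr_chart i) (fr_chart j) q <= fr_row j q)%MS.
  apply/row_subP => s; rewrite row_mul; apply/(fr_char _ jq).
  apply: char_distribution_Jac; [exact: iq.1|exact: jq.1|].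
  by apply/(fr_char _ iq); exact: row_sub.
move=> /submxP[D E].
by rewrite /cocycle E -(mulmxA D) fr_rowK// mulmx1.
Qed.

Lemma cocycleM i j l q : fr_dom i q -> fr_dom j q -> fr_dom l q ->
  cocycle i j q *m cocycle j l q = cocycle i l q.
Proof.
move=> iq jq lq; rewrite {2}/cocycle.
rewrite (mulmxA (cocycle i j q)) (mulmxA (cocycle i j q)) (cocycle_row iq jq).
rewrite -(mulmxA (fr_row i q)).
by congr (_ *m _ *m _); exact: JacM iq.1 jq.1 lq.1.
Qed.

Lemma cocycle1 j q : fr_dom j q -> cocycle j j q = 1%:M.
Proof. by move=> jq; rewrite /cocycle (Jac1 jq.1) mulmx1 fr_rowK. Qed.

Lemma near_fr_dom j i q : fr_dom j q -> fr_dom i q ->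
  \forall x \near chi j q, fr_dom i (inv (fr_chart j) x) /\ chi j (inv (fr_chart j) x) = x.
Proof.
move=> jq iq; have iq' := open_nbhs_nbhs (conj (@fr_dom_open i) iq).
apply: filterS2 (near_chart_im jq.1) (near_chart_inv jq.1 iq') => x xj xi.
by split=> //; have [] := chart_im_inv xj.
Qed.

Lemma smooth_at_fr_row i j q : fr_dom i q -> fr_dom j q ->
  smooth_at (fun x => fr_row j (inv (fr_chart i) x)) (chi i q).
Proof.
move=> iq jq; apply: (smooth_at_chart jq.1 iq.1).
apply: smooth_at_eq (smooth_at_fr jq.2).
by apply: filterS (near_fr_dom jq jq) => x [_ E]; rewrite /fr_row E.
Qed.

Lemma smooth_at_cocycle i j q : fr_dom i q -> fr_dom j q ->
  smooth_at (fun x => cocycle i j (inv (fr_chart i) x)) (chi i q).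
Proof.
move=> iq jq; have Fj := smooth_at_fr_row iq jq; have FjT := smooth_at_trmx Fj.
apply: smooth_at_mulmx; first apply: smooth_at_mulmx.
- exact: smooth_at_fr_row.
- exact: (smooth_at_Jac iq.1 jq.1).
- apply: (smooth_at_mulmx FjT); apply: smooth_at_invmx.
    exact: smooth_at_mulmx Fj FjT.
  by rewrite chart_mapK; [apply/gram_unit/fr_free|exact: iq.1].
Qed.

End Frames.

Section Blocks.
Context {R : realType}.

Lemma ev1_col0 n r (l : 'cV[R]_n) (w : 'rV[R]_(n + r)) :
  ev1 (col_mx l (0 : 'cV[R]_r)) w = ev1 l (lsubmx w).
Proof. by rewrite /ev1 -{1}(hsubmxK w) mul_row_col mulmx0 addr0. Qed.

Lemma ev2_block0 n r (A : 'M[R]_n) (v w : 'rV[R]_(n + r)) :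
  ev2 (block_mx A (0 : 'M[R]_(n, r)) 0 (0 : 'M[R]_(r, r))) v w = ev2 A (lsubmx v) (lsubmx w).
Proof.
rewrite /ev2 -{1}(hsubmxK v) -{1}(hsubmxK w) mul_row_block !mulmx0 !addr0.
by rewrite tr_row_mx mul_row_col mul0mx addr0.
Qed.

Lemma derive_lsub_out (V : normedModType R) m n p (f : V -> 'M[R]_(m, n + p)) x v :
  differentiable f x -> lsubmx ('D_v f x) = 'D_v (fun y => lsubmx (f y)) x.
Proof.
move=> df; have dl : derivable (fun y => lsubmx (f y)) x v.
  apply/derivable_mxP => i j.
  have -> : (fun y => lsubmx (f y) i j) = (fun y => f y i (lshift p j)).
    by apply/funext => y; rewrite mxE.
  by apply/(iffLR (derivable_mxP _ _ _))/diff_derivable.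
apply/matrixP => i j; rewrite (derive_mx dl) [RHS]mxE [LHS]mxE.
have -> : (fun y => lsubmx (f y) i j) = (fun y => f y i (lshift p j)).
  by apply/funext => y; rewrite mxE.
exact: esym (derive_coord v i _ df).
Qed.

End Blocks.

(** * The total space in coordinates *)

(** Coordinates on the total space are rows (x, xi) of length n + r: x is the
    point of M in a chart, xi the components in a frame of a vector of V.
    The matrices G a p are those of a Riemannian metric on M. *)
Section Thickening.
Context {R : realType} {n k : nat}.
Variables (M : k_precosymplectic R n k) (r : nat).
Variable G : atlas_index M -> M -> 'M[R]_n.
Hypothesis G_smooth : forall a p, chart_dom (atlas a) p ->
  smooth_at (fun x => G a (chart_inv (atlas a) x)) (atlas a p).
Hypothesis G_Jac : forall a b p, chart_dom (atlas a) p -> chart_dom (atlas b) p ->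
  G a p = Jac a b p *m G b p *m (Jac a b p)^T.
Hypothesis G_definite : forall a p v, chart_dom (atlas a) p -> ev2 (G a p) v v = 0 -> v = 0.

Notation dom a := (chart_dom (atlas a)).
Notation inv a := (chart_inv (atlas a)).
Notation frame := (frame M r).
Implicit Types (i j l : frame) (q : M).
Notation chi j := (atlas (fr_chart j)).
Notation eta := (kpc_eta M).
Notation omega := (kpc_omega M).

Definition base j (y : 'rV[R]_(n + r)) : M := inv (fr_chart j) (lsubmx y).

Definition tot_im j : set 'rV[R]_(n + r) := [set y | fr_im j (lsubmx y)].

Lemma lsubmx_continuous (y : 'rV[R]_(n + r)) : {for y, continuous (@lsubmx R 1 n r)}.
Proof. exact/smooth_at_continuous/smooth_at_lsubmx/smooth_at_id. Qed.

Lemma base_dom j y : tot_im j y -> fr_dom j (base j y) /\ chi j (base j y) = lsubmx y.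
Proof. exact: fr_dom_inv. Qed.

Lemma near_base j y (P : set M) : tot_im j y -> nbhs (base j y) P ->
  \forall z \near y, P (base j z).
Proof.
move=> jy Py; have [jq E] := base_dom jy.
have := near_chart_inv jq.1 Py; rewrite E => H; exact: (lsubmx_continuous H).
Qed.

Lemma near_tot_im j y : tot_im j y -> \forall z \near y, tot_im j z.
Proof.
move=> jy; apply: (@lsubmx_continuous y (fr_im j)).
by apply: open_nbhs_nbhs; split; [exact: fr_open|].
Qed.

Lemma near_fr_dom_base i j y : tot_im i y -> fr_dom j (base i y) ->
  \forall z \near y, tot_im i z /\ fr_dom j (base i z).
Proof.
move=> iy jy; apply: filterI; first exact: near_tot_im.
by apply: near_base => //; apply: open_nbhs_nbhs; split=> //; exact: fr_dom_open.
Qed.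

Lemma smooth_at_pull m p (f : 'rV[R]_n -> 'M[R]_(m, p)) (y : 'rV[R]_(n + r)) :
  smooth_at f (lsubmx y) -> smooth_at (fun z : 'rV[R]_(n + r) => f (lsubmx z)) y.
Proof. by move=> fy; apply: (smooth_at_comp_mx (smooth_at_lsubmx (smooth_at_id y)) fy). Qed.

(** The change of coordinates of the total space from the frame i to the frame j. *)
Definition tau i j (y : 'rV[R]_(n + r)) : 'rV[R]_(n + r) :=
  row_mx (transition (chi i) (chi j) (lsubmx y)) (rsubmx y *m cocycle i j (base i y)).

Lemma smooth_at_tau i j y : tot_im i y -> fr_dom j (base i y) -> smooth_at (tau i j) y.
Proof.
move=> iy jq; have [iq E] := base_dom iy.
apply: smooth_at_row_mx.
  by apply: smooth_at_pull; rewrite -E; exact: smooth_at_transition iq.1 jq.1.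
apply: smooth_at_mulmx; first exact/smooth_at_rsubmx/smooth_at_id.
apply: (@smooth_at_pull _ _ (fun x => cocycle i j (inv (fr_chart i) x))).
by rewrite -E; exact: smooth_at_cocycle.
Qed.

Lemma lsub_tau i j y : tot_im i y -> lsubmx (tau i j y) = chi j (base i y).
Proof. by move=> iy; rewrite row_mxKl. Qed.

Lemma tot_im_tau i j y : tot_im i y -> fr_dom j (base i y) -> tot_im j (tau i j y).
Proof. by move=> iy jq; rewrite /tot_im /= lsub_tau//; have [] := jq. Qed.

Lemma base_tau i j y : tot_im i y -> fr_dom j (base i y) -> base j (tau i j y) = base i y.
Proof. by move=> iy jq; rewrite /base lsub_tau// chart_mapK//; have [] := jq. Qed.

Lemma tau_tau i j l y : tot_im i y -> fr_dom j (base i y) -> fr_dom l (base i y) ->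
  tau j l (tau i j y) = tau i l y.
Proof.
move=> iy jq lq; have [iq E] := base_dom iy.
have -> : tau j l (tau i j y) = row_mx (transition (chi j) (chi l) (lsubmx (tau i j y)))
    (rsubmx (tau i j y) *m cocycle j l (base j (tau i j y))) by [].
rewrite (base_tau iy jq) (lsub_tau j iy) (transitionE (fr_chart l) jq.1).
by rewrite [rsubmx (tau i j y)]row_mxKr -mulmxA (cocycleM iq jq lq).
Qed.

Lemma tau_id j y : tot_im j y -> tau j j y = y.
Proof.
move=> jy; have [jq E] := base_dom jy.
rewrite /tau cocycle1// mulmx1 -{1}E (transitionE _ jq.1) E; exact: hsubmxK.
Qed.

(** The change of coordinates covers that of M, so its differential covers the
    jacobian; this is all that pulled back forms see of it. *)
Lemma lsub_Jtau i j y (w : 'rV[R]_(n + r)) : tot_im i y -> fr_dom j (base i y) ->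
  lsubmx (w *m 'J (tau i j) y) = lsubmx w *m Jac (fr_chart i) (fr_chart j) (base i y).
Proof.
move=> iy jq; have [iq E] := base_dom iy.
have dt := smooth_at_differentiable (smooth_at_tau iy jq).
have st := smooth_at_transition iq.1 jq.1; rewrite E in st.
rewrite -(deriveEjacobian _ dt) derive_lsub_out//.
rewrite /Jac E -(deriveEjacobian _ (smooth_at_differentiable st)) -derive_lsubmx.
by congr ('D_w _ y); apply/funext => z; rewrite row_mxKl.
Qed.

Lemma Jtau_inv i j y : tot_im i y -> fr_dom j (base i y) ->
  'J (tau j i) (tau i j y) *m 'J (tau i j) y = 1%:M.
Proof.
move=> iy jq; have [iq E] := base_dom iy; apply: mulmx1C.
have sij := smooth_at_tau iy jq.
have sji : smooth_at (tau j i) (tau i j y).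
  by apply: smooth_at_tau; [exact: tot_im_tau|rewrite base_tau].
rewrite -(jacobian_comp (smooth_at_differentiable sij) (smooth_at_differentiable sji)).
have did : differentiable (id : 'rV[R]_(n + r) -> 'rV[R]_(n + r)) y.
  exact/smooth_at_differentiable/smooth_at_id.
have -> : 'J (tau j i \o tau i j) y = 'J (id : 'rV[R]_(n + r) -> 'rV[R]_(n + r)) y.
  apply/esym/near_eq_jacobian => //.
  apply: filterS (near_fr_dom_base iy jq) => z [iz jz] /=.
  by rewrite tau_tau// ?tau_id//; have [] := base_dom iz.
by apply/row_matrixP => s; rewrite !rowE mulmx1 -(deriveEjacobian _ did); exact: derive_id.
Qed.

(** The components of pi^* eta_s. *)
Definition eta_loc (s : 'I_k) j (y : 'rV[R]_(n + r)) : 'cV[R]_(n + r) :=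
  col_mx (eta s (fr_chart j) (lsubmx y)) 0.

(** The covectors g(F_a, -), for F_a the vectors of the frame. *)
Definition fr_metric j (x : 'rV[R]_n) : 'M[R]_(r, n) :=
  fr_mx j x *m G (fr_chart j) (inv (fr_chart j) x).

(** The tautological one-form: at (x, xi) it sends (v, zeta) to g(xi, v). *)
Definition lam j (y : 'rV[R]_(n + r)) : 'cV[R]_(n + r) :=
  col_mx (rsubmx y *m fr_metric j (lsubmx y))^T 0.

(** The components of pi^* omega_s + d lambda. *)
Definition omega_loc (s : 'I_k) j (y : 'rV[R]_(n + r)) : 'M[R]_(n + r) :=
  block_mx (omega s (fr_chart j) (lsubmx y)) 0 0 0 + extd1 (lam j) y.

Lemma smooth_at_eta_loc s j y : tot_im j y -> smooth_at (eta_loc s j) y.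
Proof.
move=> jy; apply: smooth_at_col_mx; last exact: smooth_at_cst.
apply: smooth_at_pull; apply: smooth_onW (form1_smooth (eta s) (fr_chart j)) _.
  exact: chart_im_open.
exact: fr_sub.
Qed.

Lemma smooth_at_fr_metric j y : tot_im j y -> smooth_at (fr_metric j) (lsubmx y).
Proof.
move=> jy; apply: smooth_at_mulmx; first exact: smooth_at_fr.
by have [jq <-] := base_dom jy; exact: G_smooth jq.1.
Qed.

Lemma smooth_at_lam j y : tot_im j y -> smooth_at (lam j) y.
Proof.
move=> jy; apply: smooth_at_col_mx; last exact: smooth_at_cst.
apply: smooth_at_trmx; apply: smooth_at_mulmx; first exact/smooth_at_rsubmx/smooth_at_id.
by apply: smooth_at_pull; exact: smooth_at_fr_metric.
Qed.

Lemma smooth_at_omega_pull s j y : tot_im j y ->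
  smooth_at (fun y : 'rV[R]_(n + r) =>
    block_mx (omega s (fr_chart j) (lsubmx y)) 0 0 0 : 'M[R]_(n + r)) y.
Proof.
move=> jy; apply: smooth_at_col_mx; last exact: smooth_at_cst.
apply: smooth_at_row_mx; last exact: smooth_at_cst.
apply: smooth_at_pull; apply: smooth_onW (form2_smooth (omega s) (fr_chart j)) _.
  exact: chart_im_open.
exact: fr_sub.
Qed.

Lemma smooth_at_omega_loc s j y : tot_im j y -> smooth_at (omega_loc s j) y.
Proof.
move=> jy; apply: smooth_atD; first exact: smooth_at_omega_pull.
exact/smooth_at_extd1/smooth_at_lam.
Qed.

Lemma eta_loc_tau s i j y w : tot_im i y -> fr_dom j (base i y) ->
  ev1 (eta_loc s i y) w = ev1 (eta_loc s j (tau i j y)) (w *m 'J (tau i j) y).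
Proof.
move=> iy jq; have [iq E] := base_dom iy.
rewrite !ev1_col0 lsub_Jtau// lsub_tau// -E.
by rewrite (form1_transition _ iq.1 jq.1) (diff_transition _ iq.1 jq.1).
Qed.

Lemma ev1_lam j y w : ev1 (lam j y) w = (rsubmx y *m fr_metric j (lsubmx y) *m (lsubmx w)^T) 0 0.
Proof.
rewrite ev1_col0 /ev1; set A := rsubmx y *m _.
by rewrite -(trmx11 (A *m (lsubmx w)^T)) (trmx_mul A) trmxK.
Qed.

(** The one-form g(xi, -) does not depend on the coordinates: the cocycle
    carries xi and the jacobian carries g. *)
Lemma lam_tau i j y w : tot_im i y -> fr_dom j (base i y) ->
  ev1 (lam i y) w = ev1 (lam j (tau i j y)) (w *m 'J (tau i j) y).
Proof.
move=> iy jq; have [iq E] := base_dom iy.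
rewrite !ev1_lam lsub_Jtau// (lsub_tau j iy) row_mxKr /fr_metric.
rewrite -/(base i y) chart_mapK; last exact: jq.1.
rewrite -[fr_mx j _]/(fr_row j (base i y)) -{1}E -[fr_mx i _]/(fr_row i (base i y)).
rewrite (G_Jac iq.1 jq.1) trmx_mul.
move: (cocycle_row iq jq); move: (cocycle i j _) => C CE; rewrite !mulmxA.
by congr ((_ *m _ *m _ *m _) 0 0); rewrite -!mulmxA CE.
Qed.

Lemma omega_loc_tau s i j y v w : tot_im i y -> fr_dom j (base i y) ->
  ev2 (omega_loc s i y) v w =
  ev2 (omega_loc s j (tau i j y)) (v *m 'J (tau i j) y) (w *m 'J (tau i j) y).
Proof.
move=> iy jq; have [iq E] := base_dom iy.
apply: etrans (ev2D _ _ _ _) _; apply: etrans _ (esym (ev2D _ _ _ _)); congr (_ + _).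
  rewrite 2!ev2_block0 (lsub_Jtau v iy jq) (lsub_Jtau w iy jq) (lsub_tau j iy) -E.
  rewrite (form2_transition _ iq.1 jq.1).
  by rewrite (diff_transition _ iq.1 jq.1) (diff_transition _ iq.1 jq.1).
apply: extd1_pullback;
  [exact: smooth_at_lam|exact/smooth_at_lam/tot_im_tau|exact: smooth_at_tau|].
apply: filterS (near_fr_dom_base iy jq) => z [iz jz] u; exact: lam_tau.
Qed.

Lemma eta_loc_closed s j y u v : tot_im j y -> ext_d1 (eta_loc s j) y u v = 0.
Proof.
move=> jy; have := @kpc_eta_closed _ _ _ M s (fr_chart j) _ (@fr_sub _ _ _ _ _ j _ jy).
move=> /(_ (lsubmx u) (lsubmx v)); rewrite /ext_d1 => <-.
congr (_ - _); rewrite -derive_lsubmx.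
  by congr ('D_u _ y); apply/funext => z; exact: ev1_col0.
by congr ('D_v _ y); apply/funext => z; exact: ev1_col0.
Qed.

Lemma ext_d2D m (A B : 'rV[R]_m -> 'M[R]_m) x u v w : smooth_at A x -> smooth_at B x ->
  ext_d2 (fun y => A y + B y) x u v w = ext_d2 A x u v w + ext_d2 B x u v w.
Proof.
move=> Ax Bx.
have E a b c : 'D_a (fun y => ev2 (A y + B y) b c) x =
    'D_a (fun y => ev2 (A y) b c) x + 'D_a (fun y => ev2 (B y) b c) x.
  rewrite -deriveD; first last.
  - by apply/diff_derivable/smooth_at_differentiable/smooth_at_ev2.
  - by apply/diff_derivable/smooth_at_differentiable/smooth_at_ev2.
  by congr ('D_a _ x); apply/funext => y; exact: ev2D.
rewrite /ext_d2 (E u v w) (E v u w) (E w u v) {E}.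
set a := ('D_u _ x); set b := ('D_u _ x); set c := ('D_v _ x).
set d := ('D_v _ x); set e := ('D_w _ x); set f := ('D_w _ x); ring.
Qed.

Lemma omega_loc_closed s j y u v w : tot_im j y -> ext_d2 (omega_loc s j) y u v w = 0.
Proof.
move=> jy; rewrite ext_d2D; first last.
- exact/smooth_at_extd1/smooth_at_lam.
- exact: smooth_at_omega_pull.
rewrite (extd1_closed u v w (smooth_at_lam jy)) addr0.
have := @kpc_omega_closed _ _ _ M s (fr_chart j) _ (@fr_sub _ _ _ _ _ j _ jy).
move=> /(_ (lsubmx u) (lsubmx v) (lsubmx w)); rewrite /ext_d2 => <-.
congr (_ - _ + _); rewrite -derive_lsubmx.
- by congr ('D_u _ y); apply/funext => z; exact: ev2_block0.
- by congr ('D_v _ y); apply/funext => z; exact: ev2_block0.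
- by congr ('D_w _ y); apply/funext => z; exact: ev2_block0.
Qed.

Lemma omega_loc_skew s j y : tot_im j y -> (omega_loc s j y)^T = - omega_loc s j y.
Proof.
move=> jy; rewrite /omega_loc; set A := block_mx _ _ _ _; set B := extd1 _ _.
have -> : (A + B)^T = A^T + B^T by apply/matrixP => a b; rewrite !mxE.
rewrite opprD {2}/B -extd1_skew; congr (_ + _); rewrite /A.
rewrite tr_block_mx !trmx0 (form2_skew (omega s)) ?opp_block_mx ?oppr0//.
exact: (@fr_sub _ _ _ _ _ j _ jy).
Qed.

(** * Where the characteristic distribution is trivial *)

Definition char_trivial j (y : 'rV[R]_(n + r)) : Prop := forall v : 'rV[R]_(n + r),
  (forall s, ev1 (eta_loc s j y) v = 0) ->
  (forall s w, ev2 (omega_loc s j y) v w = 0) -> v = 0.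

Lemma char_trivial_tau i j y : tot_im i y -> fr_dom j (base i y) ->
  char_trivial i y -> char_trivial j (tau i j y).
Proof.
move=> iy jq tri v v1 v2; set J' := 'J (tau j i) (tau i j y).
have vE : v = v *m J' *m 'J (tau i j) y by rewrite -mulmxA Jtau_inv// mulmx1.
(* The jacobian is invertible, so v is the image of v J'. *)
suff v0 : v *m J' = 0 by rewrite vE v0 mul0mx.
apply: tri => [s|s w]; first by rewrite (eta_loc_tau _ _ iy jq) -vE.
by rewrite (omega_loc_tau _ _ _ iy jq) -vE.
Qed.

Lemma char_trivial_tauE i j y : tot_im i y -> fr_dom j (base i y) ->
  char_trivial i y <-> char_trivial j (tau i j y).
Proof.
move=> iy jq; split; first exact: char_trivial_tau.
have iq := (base_dom iy).1.
move=> /(@char_trivial_tau j i (tau i j y) (tot_im_tau iy jq)).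
by rewrite (base_tau iy jq) (tau_tau iy jq iq) (tau_id iy); apply.
Qed.

(** A sum of positive semidefinite matrices whose kernel is the common kernel of
    the forms: openness of [char_trivial] becomes the nonvanishing of a
    determinant. *)
Definition char_gram j (y : 'rV[R]_(n + r)) : 'M[R]_(n + r) :=
  \sum_s (eta_loc s j y *m (eta_loc s j y)^T + omega_loc s j y *m (omega_loc s j y)^T).

Lemma char_trivial_unit j y : char_trivial j y <-> char_gram j y \in unitmx.
Proof.
have ev v : ev2 (char_gram j y) v v =
    \sum_s (sqnorm (v *m eta_loc s j y) + sqnorm (v *m omega_loc s j y)).
  rewrite /ev2 mulmx_sumr mulmx_suml summxE; apply: eq_bigr => s _.
  by rewrite -!ev2_mxtr -ev2D.
split=> [tri|U v v1 v2].
  rewrite -row_free_unit; apply: inj_row_free => v vS; apply: tri => [s|s w].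
    have : ev2 (char_gram j y) v v = 0 by rewrite /ev2 vS mul0mx mxE.
    move=> /eqP; rewrite ev psumr_eq0 => [/allP/(_ s)|s' _]; last by rewrite addr_ge0 ?sqnorm_ge0.
    rewrite mem_index_enum paddr_eq0 ?sqnorm_ge0// => /(_ isT)/andP[/eqP/sqnorm_eq0 E _].
    by rewrite /ev1 E mxE.
  have : ev2 (char_gram j y) v v = 0 by rewrite /ev2 vS mul0mx mxE.
  move=> /eqP; rewrite ev psumr_eq0 => [/allP/(_ s)|s' _]; last by rewrite addr_ge0 ?sqnorm_ge0.
  rewrite mem_index_enum paddr_eq0 ?sqnorm_ge0// => /(_ isT)/andP[_ /eqP/sqnorm_eq0 E].
  by rewrite /ev2 E mul0mx mxE.
have vS : v *m char_gram j y = 0.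
  rewrite mulmx_sumr big1// => s _.
  have e1 : v *m eta_loc s j y = 0.
    by apply/matrixP => a b; rewrite !ord1 [RHS]mxE; exact: v1.
  have e2 : v *m omega_loc s j y = 0.
    apply/rowP => b; rewrite [RHS]mxE -(v2 s (delta_mx 0 b)) /ev2.
    by rewrite trmx_delta -(colE b) [RHS]mxE.
  by rewrite mulmxDr !mulmxA e1 e2 !mul0mx addr0.
by rewrite -(mulmxK U v) vS mul0mx.
Qed.

Lemma near_char_trivial j y : tot_im j y -> char_trivial j y -> \forall z \near y, char_trivial j z.
Proof.
move=> jy /char_trivial_unit; rewrite unitmxE unitfE => d0.
have sd : smooth_at (fun z => \det (char_gram j z)) y.
  apply: smooth_at_det; apply: smooth_at_sum => s _; apply: smooth_atD.
    have e := smooth_at_eta_loc s jy; exact: smooth_at_mulmx e (smooth_at_trmx e).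
  have o := smooth_at_omega_loc s jy; exact: smooth_at_mulmx o (smooth_at_trmx o).
have /cvgr_neq0/(_ d0) := smooth_at_continuous sd.
by apply: filterS => z; rewrite -unitfE -unitmxE => /char_trivial_unit.
Qed.

(** Along the zero section only the derivative of the factor xi of lambda survives. *)
Lemma extd1_lam0 j (x : 'rV[R]_n) (u v : 'rV[R]_(n + r)) : fr_im j x ->
  ev2 (extd1 (lam j) (row_mx x 0)) u v =
  (rsubmx u *m fr_metric j x *m (lsubmx v)^T) 0 0 -
  (rsubmx v *m fr_metric j x *m (lsubmx u)^T) 0 0.
Proof.
move=> jx; set y := row_mx x (0 : 'rV[R]_r).
have lE : lsubmx y = x by rewrite row_mxKl.
have jy : tot_im j y by rewrite /tot_im /= lE.
have key (a b : 'rV[R]_(n + r)) : 'D_a (fun z => ev1 (lam j z) b) y =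
    (rsubmx a *m fr_metric j x *m (lsubmx b)^T) 0 0.
  have -> : (fun z => ev1 (lam j z) b) =
      (fun z => (rsubmx z *m (fr_metric j (lsubmx z) *m (lsubmx b)^T)) 0 0).
    by apply/funext => z; rewrite ev1_lam mulmxA.
  have s1 : smooth_at (fun z : 'rV[R]_(n + r) => rsubmx z) y.
    exact/smooth_at_rsubmx/smooth_at_id.
  have s2 : smooth_at (fun z : 'rV[R]_(n + r) => fr_metric j (lsubmx z) *m (lsubmx b)^T) y.
    apply: smooth_at_mulmx; last exact: smooth_at_cst.
    by apply: smooth_at_pull; exact: smooth_at_fr_metric.
  have s12 := smooth_at_mulmx s1 s2.
  rewrite (derive_coord _ _ _ (smooth_at_differentiable s12)).
  have [_ ->] := differentiable_mulmx a (smooth_at_differentiable s1) (smooth_at_differentiable s2).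
  have -> : rsubmx y = 0 by rewrite row_mxKr.
  rewrite mul0mx addr0 lE mulmxA.
  have -> // : 'D_a (fun z : 'rV[R]_(n + r) => rsubmx z) y = rsubmx a.
  apply/rowP => t; rewrite -(derive_coord a 0 t (smooth_at_differentiable s1)).
  have -> : (fun z : 'rV[R]_(n + r) => rsubmx z 0 t) = (fun z => z 0 (rshift n t)).
    by apply/funext => z; rewrite mxE.
  have did := smooth_at_differentiable (smooth_at_id y).
  rewrite [RHS]mxE; apply: etrans (derive_coord a 0 (rshift n t) did) _.
  by rewrite (derive_id y a).
by rewrite (ev2_extd1 _ _ (smooth_at_lam jy)) /ext_d1 (key u v) (key v u).
Qed.

Lemma omega_loc0 s j x (u v : 'rV[R]_(n + r)) : fr_im j x ->
  ev2 (omega_loc s j (row_mx x 0)) u v =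
  ev2 (omega s (fr_chart j) x) (lsubmx u) (lsubmx v) +
  ((rsubmx u *m fr_metric j x *m (lsubmx v)^T) 0 0 -
   (rsubmx v *m fr_metric j x *m (lsubmx u)^T) 0 0).
Proof.
move=> jx; apply: etrans (ev2D _ _ _ _) _.
by rewrite ev2_block0 row_mxKl (extd1_lam0 _ _ jx).
Qed.

Lemma fr_metric_inj j q (u : 'rV[R]_r) : fr_dom j q ->
  (u *m fr_metric j (chi j q) *m (u *m fr_row j q)^T) 0 0 = 0 -> u = 0.
Proof.
move=> jq H; apply: (row_free_inj (fr_free jq)); rewrite mul0mx.
apply: (G_definite jq.1); rewrite -H /ev2 /fr_metric chart_mapK ?mulmxA//; exact: jq.1.
Qed.

(** A characteristic vector (v, xi) at the zero section: pairing with (xi, 0) gives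
    g(xi, xi) = 0; then v lies in V, and pairing with (0, v) gives g(v, v) = 0. *)
Lemma char_trivial0 j q (k0 : 'I_k) : fr_dom j q -> char_trivial j (row_mx (chi j q) 0).
Proof.
move=> jq v v1 v2; have jx := jq.2.
have H s w := etrans (esym (omega_loc0 s v w jx)) (v2 s w).
have rv : rsubmx v = 0.
  apply: (fr_metric_inj jq).
  have Vr : char_distribution M (fr_chart j) q (rsubmx v *m fr_row j q).
    by apply/(fr_char _ jq); exact: submxMl.
  have := H k0 (row_mx (rsubmx v *m fr_row j q) 0).
  rewrite row_mxKl row_mxKr !mul0mx [X in _ - X]mxE subr0 ev2_skew; last first.
    by apply: form2_skew; exact: chart_imP jq.1.
  by rewrite Vr.2 oppr0 add0r.
have lv : lsubmx v = 0.
  have H' s w : ev2 (omega s (fr_chart j) (chi j q)) (lsubmx v) w = 0.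
    have := H s (row_mx w 0).
    by rewrite rv row_mxKl row_mxKr !mul0mx !mxE subrr addr0.
  have Vl : char_distribution M (fr_chart j) q (lsubmx v).
    split=> [s|//]; have := v1 s; rewrite ev1_col0 row_mxKl; exact.
  have /submxP[u uE] := (fr_char _ jq).1 Vl.
  have u0 : u = 0.
    apply: (fr_metric_inj jq).
    have := H k0 (row_mx 0 u).
    rewrite row_mxKl row_mxKr rv mul0mx mul0mx -uE.
    rewrite /ev2 trmx0 mulmx0 !mxE add0r sub0r => /eqP; rewrite oppr_eq0 => /eqP.
    exact.
  by rewrite uE u0 mul0mx.
by rewrite -(hsubmxK v) rv lv row_mx0.
Qed.

(** * The k-cosymplectic manifold *)

Variable ref_frame : M -> frame.
Hypothesis ref_frame_dom : forall q, fr_dom (ref_frame q) q.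

(** The second entry of a point over q is the row of components, in the frame
    [ref_frame q], of a vector of V at q. *)
Notation point := (M * 'rV[R]_r)%type.

Definition bundle_map j (z : point) : 'rV[R]_(n + r) :=
  row_mx (chi j z.1) (z.2 *m cocycle (ref_frame z.1) j z.1).

Definition bundle_inv j (y : 'rV[R]_(n + r)) : point :=
  (base j y, rsubmx y *m cocycle j (ref_frame (base j y)) (base j y)).

Lemma base_bundle_map j z : fr_dom j z.1 -> base j (bundle_map j z) = z.1.
Proof. by move=> jz; rewrite /base row_mxKl chart_mapK//; exact: jz.1. Qed.

Lemma tot_im_bundle_map j z : fr_dom j z.1 -> tot_im j (bundle_map j z).
Proof. by move=> jz; rewrite /tot_im /= row_mxKl; exact: jz.2. Qed.

Lemma bundle_mapK j z : fr_dom j z.1 -> bundle_inv j (bundle_map j z) = z.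
Proof.
move=> jz; rewrite /bundle_inv base_bundle_map// row_mxKr -mulmxA.
have kz := ref_frame_dom z.1.
by rewrite (cocycleM kz jz kz) (cocycle1 kz) mulmx1 -surjective_pairing.
Qed.

Lemma bundle_map_inv i j y : tot_im i y -> fr_dom j (base i y) ->
  bundle_map j (bundle_inv i y) = tau i j y.
Proof.
move=> iy jq; have [iq E] := base_dom iy; rewrite /bundle_map /bundle_inv /= -mulmxA.
by rewrite (cocycleM iq (ref_frame_dom _) jq).
Qed.

Lemma tau_bundle_map i j z : fr_dom i z.1 -> fr_dom j z.1 ->
  tau i j (bundle_map i z) = bundle_map j z.
Proof.
move=> iz jz; have iy := tot_im_bundle_map iz.
by rewrite -bundle_map_inv// ?bundle_mapK// base_bundle_map.
Qed.

Definition nondegenerate (z : point) : Prop :=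
  char_trivial (ref_frame z.1) (bundle_map (ref_frame z.1) z).

Lemma nondegenerate_char_trivial j z : fr_dom j z.1 ->
  nondegenerate z <-> char_trivial j (bundle_map j z).
Proof.
move=> jz; have kz := ref_frame_dom z.1; rewrite -(tau_bundle_map kz jz).
by apply: (char_trivial_tauE (tot_im_bundle_map kz)); rewrite base_bundle_map.
Qed.

Definition tot : Type := {z : point | `[< nondegenerate z >]}.
HB.instance Definition _ := Choice.on tot.

Lemma tot_nondegenerate (t : tot) : nondegenerate (val t).
Proof. by case: t => z /= /asboolP. Qed.

(** A chart is a frame together with a point of [tot], which only serves as the
    default value of the inverse chart. *)
Definition tot_dom (c : frame * tot) : set tot := [set t | fr_dom c.1 (val t).1].
Definition tot_map (c : frame * tot) (t : tot) : 'rV[R]_(n + r) := bundle_map c.1 (val t).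
Definition tot_inv (c : frame * tot) (y : 'rV[R]_(n + r)) : tot := insubd c.2 (bundle_inv c.1 y).

Lemma tot_mapK c t : tot_dom c t -> tot_inv c (tot_map c t) = t.
Proof. by move=> ct; rewrite /tot_inv /tot_map bundle_mapK// valKd. Qed.

Lemma tot_image c e : tot_map c @` (tot_dom c `&` tot_dom e) =
  [set y | [/\ tot_im c.1 y, fr_dom e.1 (base c.1 y) & char_trivial c.1 y]].
Proof.
apply/seteqP; split=> [_ [t [ct et] <-]|y [cy ey ty]].
  split; [exact: tot_im_bundle_map|by rewrite base_bundle_map|].
  by apply/nondegenerate_char_trivial => //; exact: tot_nondegenerate.
have cq := (base_dom cy).1.
have gz : nondegenerate (bundle_inv c.1 y).
  by apply/(nondegenerate_char_trivial (j := c.1)) => //; rewrite bundle_map_inv// tau_id.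
exists (exist _ (bundle_inv c.1 y) (asboolT gz) : tot); first by [].
by rewrite /tot_map /= bundle_map_inv// tau_id.
Qed.

Lemma near_tot_image c e y : (tot_map c @` (tot_dom c `&` tot_dom e)) y ->
  \forall z \near y, (tot_map c @` (tot_dom c `&` tot_dom e)) z.
Proof.
rewrite tot_image => -[cy ey ty].
apply: filterS2 (near_fr_dom_base cy ey) (near_char_trivial cy ty).
by move=> z [cz ez] tz.
Qed.

Lemma tot_open c e : open (tot_map c @` (tot_dom c `&` tot_dom e)).
Proof. by rewrite openE => y /near_tot_image. Qed.

Lemma tot_transition c e y : (tot_map c @` (tot_dom c `&` tot_dom e)) y ->
  tot_map e (tot_inv c y) = tau c.1 e.1 y.
Proof.
move=> [t [ct et] <-]; rewrite tot_mapK//.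
by rewrite /tot_map tau_bundle_map.
Qed.

Lemma tot_smooth c e : smooth_on (tot_map c @` (tot_dom c `&` tot_dom e))
  (fun y => tot_map e (tot_inv c y)).
Proof.
apply: smooth_onP => y cey; apply: (@smooth_at_eq _ _ _ (tau c.1 e.1)).
  by apply: filterS (near_tot_image cey) => z /tot_transition ->.
by move: cey; rewrite tot_image => -[cy ey _]; exact: smooth_at_tau.
Qed.

Lemma tot_cover t : exists c, tot_dom c t.
Proof. by exists (ref_frame (val t).1, t); exact: ref_frame_dom. Qed.

Definition tot_data : chart_data R (n + r) :=
  ChartData tot_cover tot_mapK tot_open tot_smooth.

Definition tot_proj (t : glued tot_data) : M := (val (t : tot)).1.

Lemma tot_proj_inv c y : tot_im c.1 y -> char_trivial c.1 y -> tot_proj (tot_inv c y) = base c.1 y.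
Proof.
move=> cy ty; have cq := (base_dom cy).1.
have : (tot_map c @` (tot_dom c `&` tot_dom c)) y by rewrite tot_image.
move=> [t [ct _] <-]; rewrite tot_mapK// base_bundle_map//.
Qed.

Lemma tot_proj_inv_continuous c y : (tot_map c @` tot_dom c) y ->
  {for y, continuous (tot_proj \o (tot_inv c : _ -> glued tot_data))}.
Proof.
rewrite -(setIid (tot_dom c)) => cy.
have tot_manifold : \forall z \near y, tot_proj (tot_inv c z) = base c.1 z.
  by apply: filterS (near_tot_image cy); rewrite tot_image => z [? _ ?]; exact: tot_proj_inv.
move=> P; rewrite /= (nbhs_singleton tot_manifold) => Py.
have cy' : tot_im c.1 y by move: cy; rewrite tot_image => -[].
by apply: filterS2 tot_manifold (near_base cy' Py) => z /= ->.
Qed.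

Lemma tot_hausdorff : hausdorff_space (glued tot_data).
Proof.
apply: (@glued_hausdorff _ _ tot_data M tot_proj (@manifold_hausdorff _ _ M)).
  exact: tot_proj_inv_continuous.
move=> s t st; exists (ref_frame (tot_proj s), s); split; first exact: ref_frame_dom.
by rewrite /= /tot_dom /= st; exact: ref_frame_dom.
Qed.

Lemma tot_second_countable : @second_countable (glued tot_data).
Proof.
have oW p : open_nbhs p (fr_dom (ref_frame p)).
  by split; [exact: fr_dom_open|exact: ref_frame_dom].
have [s Hs] := lindelof (@manifold_second_countable _ _ M) oW.
pose s' (m : nat) : option (frame * tot) :=
  if s m is Some p then
    if pselect (exists t : tot, True) is left e then Some (ref_frame p, projT1 (cid e)) else None
  else None.
apply: (@glued_second_countable _ _ tot_data s') => t.
have [m [p [sp pt]]] := Hs (val (t : tot)).1.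
rewrite /s'; exists m; rewrite sp; case: pselect => [e|]; last by case; exists t.
by exists (ref_frame p, projT1 (cid e)).
Qed.

Definition tot_manifold : manifold R (n + r) :=
  glued_manifold tot_hausdorff tot_second_countable.

Lemma tot_chart_im (c : atlas_index tot_manifold) y : chart_im (atlas c) y ->
  tot_im c.1 y /\ char_trivial c.1 y.
Proof.
rewrite -[chart_im _]/(tot_map c @` tot_dom c) -(setIid (tot_dom c)) tot_image.
by case.
Qed.

Lemma tot_diff (c e : atlas_index tot_manifold) (p : tot_manifold) v :
  chart_dom (atlas c) p -> chart_dom (atlas e) p ->
  'd (transition (atlas c) (atlas e)) (atlas c p) v = v *m 'J (tau c.1 e.1) (tot_map c p).
Proof.
move=> cp ep.
have J : Jac c e p = 'J (tau c.1 e.1) (tot_map c p).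
  have ne : \forall y \near tot_map c p, transition (atlas c) (atlas e) y = tau c.1 e.1 y.
    have : (tot_map c @` (tot_dom c `&` tot_dom e)) (tot_map c p) by exists p.
    by move=> /near_tot_image; apply: filterS => y /tot_transition.
  exact: near_eq_jacobian ne (smooth_at_differentiable (smooth_at_transition cp ep)).
by rewrite -J; exact: (@diff_transition R (n + r) tot_manifold c e p v cp ep).
Qed.

Lemma tot_form1_smooth s (c : atlas_index tot_manifold) :
  smooth_on (chart_im (atlas c)) (eta_loc s c.1).
Proof. by apply: smooth_onP => y /tot_chart_im[cy _]; exact: smooth_at_eta_loc. Qed.

Lemma tot_form1_transition s (c e : atlas_index tot_manifold) (p : tot_manifold) :
  chart_dom (atlas c) p -> chart_dom (atlas e) p -> forall v,
  ev1 (eta_loc s c.1 (atlas c p)) v =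
  ev1 (eta_loc s e.1 (atlas e p)) ('d (transition (atlas c) (atlas e)) (atlas c p) v).
Proof.
move=> cp ep v; rewrite (tot_diff v cp ep).
have cy := tot_im_bundle_map cp.
have ey : fr_dom e.1 (base c.1 (bundle_map c.1 (val (p : tot)))) by rewrite base_bundle_map.
by have := eta_loc_tau s v cy ey; rewrite tau_bundle_map.
Qed.

Definition tot_eta s : form1 tot_manifold :=
  @Form1 R (n + r) tot_manifold (fun c => eta_loc s c.1)
    (tot_form1_smooth s) (@tot_form1_transition s).

Lemma tot_form2_skew s (c : atlas_index tot_manifold) y : chart_im (atlas c) y ->
  (omega_loc s c.1 y)^T = - omega_loc s c.1 y.
Proof. by move=> /tot_chart_im[cy _]; exact: omega_loc_skew. Qed.

Lemma tot_form2_smooth s (c : atlas_index tot_manifold) :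
  smooth_on (chart_im (atlas c)) (omega_loc s c.1).
Proof. by apply: smooth_onP => y /tot_chart_im[cy _]; exact: smooth_at_omega_loc. Qed.

Lemma tot_form2_transition s (c e : atlas_index tot_manifold) (p : tot_manifold) :
  chart_dom (atlas c) p -> chart_dom (atlas e) p -> forall v w,
  ev2 (omega_loc s c.1 (atlas c p)) v w =
  ev2 (omega_loc s e.1 (atlas e p)) ('d (transition (atlas c) (atlas e)) (atlas c p) v)
    ('d (transition (atlas c) (atlas e)) (atlas c p) w).
Proof.
move=> cp ep v w; rewrite (tot_diff v cp ep) (tot_diff w cp ep).
have cy := tot_im_bundle_map cp.
have ey : fr_dom e.1 (base c.1 (bundle_map c.1 (val (p : tot)))) by rewrite base_bundle_map.
by have := omega_loc_tau s v w cy ey; rewrite tau_bundle_map.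
Qed.

Definition tot_omega s : form2 tot_manifold :=
  @Form2 R (n + r) tot_manifold (fun c => omega_loc s c.1) (tot_form2_skew s) (tot_form2_smooth s)
    (@tot_form2_transition s).

Lemma tot_eta_closed s : closed_form1 (tot_eta s).
Proof. by move=> c y /tot_chart_im[cy _] u v; exact: eta_loc_closed. Qed.

Lemma tot_omega_closed s : closed_form2 (tot_omega s).
Proof. by move=> c y /tot_chart_im[cy _] u v w; exact: omega_loc_closed. Qed.

Definition tot_pre : k_precosymplectic R (n + r) k :=
  KPreCosymplectic tot_eta_closed tot_omega_closed.

Lemma tot_char_trivial (c : atlas_index tot_pre) (p : tot_pre) : chart_dom (atlas c) p ->
  char_distribution tot_pre c p = [set 0].
Proof.
move=> cp; have [_ tp] := tot_chart_im (chart_imP cp).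
apply/seteqP; split=> [v [v1 v2]|_ ->]; first exact: tp.
split=> [s|s w]; first by rewrite /ev1 mul0mx mxE.
by rewrite /ev2 !mul0mx mxE.
Qed.

Definition tot_cosymplectic : k_cosymplectic R (n + r) k := KCosymplectic tot_char_trivial.

(** * The zero section *)

Variable k0 : 'I_k.

Notation E := tot_cosymplectic.

Lemma bundle_map_zero j q : bundle_map j (q, 0) = row_mx (chi j q) 0.
Proof. by rewrite /bundle_map /= mul0mx. Qed.

Lemma zero_nondegenerate q : nondegenerate (q, 0).
Proof. by rewrite /nondegenerate bundle_map_zero; apply: (char_trivial0 k0). Qed.

Definition zero_section q : tot := exist _ (q, 0) (asboolT (@zero_nondegenerate q)).

Lemma zero_section_inj : injective zero_section.
Proof. by move=> p q /(congr1 (fun t : tot => (val t).1)). Qed.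

Lemma smooth_at_row0 (x : 'rV[R]_n) : smooth_at (fun x : 'rV[R]_n => row_mx x (0 : 'rV[R]_r)) x.
Proof. by apply: smooth_at_row_mx; [exact: smooth_at_id|exact: smooth_at_cst]. Qed.

Lemma zero_section_continuous : continuous (zero_section : M -> E).
Proof.
move=> p A Ap; pose c := (ref_frame p, zero_section p); have cp := ref_frame_dom p.
have im : (tot_map c @` tot_dom c) (tot_map c (zero_section p)) by exists (zero_section p).
have cA : nbhs (tot_map c (zero_section p)) (tot_inv c @^-1` A).
  have := @glued_inv_continuous _ _ tot_data c _ im A.
  by rewrite /= tot_mapK//; apply.
have [B [BA nB]] : exists B : set 'rV[R]_(n + r),
    (forall y, B y -> A (tot_inv c y)) /\ nbhs (row_mx (chi (ref_frame p) p) 0) B.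
  by exists (tot_inv c @^-1` A); split=> //; rewrite -bundle_map_zero.
have nB' := smooth_at_continuous (smooth_at_row0 (chi (ref_frame p) p)) nB.
have h : \forall q \near p, B (row_mx (chi (ref_frame p) q) 0) by exact: near_chart_map cp.1 nB'.
have oD := open_nbhs_nbhs (conj (@fr_dom_open _ _ _ _ _ (ref_frame p)) cp).
apply: filterS2 h oD => q /= /BA Aq kq.
have cq : tot_dom c (zero_section q) by [].
by rewrite -(tot_mapK cq) /tot_map /= bundle_map_zero.
Qed.

Lemma zero_section_local a (c : atlas_index E) :
  local_expr (zero_section : M -> E) (atlas a) (atlas c) =
  (fun x => row_mx (transition (atlas a) (chi c.1) x) (0 : 'rV[R]_r)).
Proof. by apply/funext => x; exact: bundle_map_zero. Qed.

Lemma zero_section_smooth a (c : atlas_index E) p : dom a p -> fr_dom c.1 p ->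
  smooth_at (local_expr (zero_section : M -> E) (atlas a) (atlas c)) (atlas a p).
Proof.
move=> ap cp; rewrite zero_section_local.
by apply: smooth_at_row_mx; [exact: smooth_at_transition ap cp.1|exact: smooth_at_cst].
Qed.

Lemma zero_section_diff a (c : atlas_index E) p v : dom a p -> fr_dom c.1 p ->
  'd (local_expr (zero_section : M -> E) (atlas a) (atlas c)) (atlas a p) v =
  row_mx (v *m Jac a (fr_chart c.1) p) (0 : 'rV[R]_r).
Proof.
move=> ap cp; have ds := smooth_at_differentiable (zero_section_smooth ap cp).
rewrite -(deriveE v ds) zero_section_local.
pose P : 'M[R]_(n, n + r) := row_mx 1%:M 0.
have -> : (fun x => row_mx (transition (atlas a) (chi c.1) x) (0 : 'rV[R]_r)) =
    (fun x => transition (atlas a) (chi c.1) x *m P).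
  by apply/funext => x; rewrite /P mul_mx_row mulmx1 mulmx0.
have dt := smooth_at_differentiable (smooth_at_transition ap cp.1).
have [_ ->] := differentiable_mulmx v dt (differentiable_cst P (atlas a p)).
rewrite derive_cst mulmx0 addr0 (deriveEjacobian _ dt).
by rewrite /P mul_mx_row mulmx1 mulmx0.
Qed.

Lemma zero_section_embedding : embedding (zero_section : M -> E).
Proof.
split; last 1 first.
- move=> U oU; exists (tot_proj @^-1` U : set E).
    apply: open_comp oU => t _; apply: glued_continuous.
    exact: tot_proj_inv_continuous.
  apply/seteqP; split=> [_ [q Uq <-]|t [Ut [q _ qt]]]; first by split; [|exists q].
  by exists q => //; rewrite -qt in Ut.
- split; first split.
  + exact: zero_section_continuous.
  + by move=> a c; apply: smooth_onP => _ [p [ap cp] <-]; exact: zero_section_smooth.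
  + move=> p a c ap cp v w; rewrite (zero_section_diff _ ap cp) (zero_section_diff _ ap cp).
    move=> /eq_row_mx[vw _].
    by rewrite -(mulmxK (Jac_unit ap cp.1) v) vw (mulmxK (Jac_unit ap cp.1)).
- exact: zero_section_inj.
Qed.

Lemma zero_section_pullback1 s : is_pullback1 (zero_section : M -> E) (kpc_eta E s) (eta s).
Proof.
move=> p a c ap cp v; rewrite (zero_section_diff v ap cp).
have -> : kpc_eta E s c (atlas c (zero_section p)) = col_mx (eta s (fr_chart c.1) (chi c.1 p)) 0.
  rewrite -[LHS]/(eta_loc s c.1 (bundle_map c.1 (p, 0))) bundle_map_zero /eta_loc.
  by rewrite row_mxKl.
rewrite ev1_col0 row_mxKl.
by rewrite (form1_transition _ ap cp.1) (diff_transition _ ap cp.1).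
Qed.

Lemma zero_section_omega s (c : atlas_index E) p u v : fr_dom c.1 p ->
  ev2 (kpc_omega E s c (atlas c (zero_section p))) u v =
  ev2 (omega s (fr_chart c.1) (chi c.1 p)) (lsubmx u) (lsubmx v) +
  ((rsubmx u *m fr_metric c.1 (chi c.1 p) *m (lsubmx v)^T) 0 0 -
   (rsubmx v *m fr_metric c.1 (chi c.1 p) *m (lsubmx u)^T) 0 0).
Proof.
move=> cp; rewrite -[kpc_omega E s c _]/(omega_loc s c.1 (bundle_map c.1 (p, 0))).
by rewrite bundle_map_zero; apply: omega_loc0; exact: cp.2.
Qed.

Lemma zero_section_pullback2 s : is_pullback2 (zero_section : M -> E) (kpc_omega E s) (omega s).
Proof.
move=> p a c ap cp v w; rewrite (zero_section_omega _ _ _ cp).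
rewrite (zero_section_diff v ap cp) (zero_section_diff w ap cp).
rewrite !row_mxKl !row_mxKr !mul0mx [X in _ + (X - X)]mxE subrr addr0.
rewrite (form2_transition _ ap cp.1).
by rewrite (diff_transition _ ap cp.1) (diff_transition _ ap cp.1).
Qed.

Lemma zero_section_slice (c : atlas_index E) :
  slice_chart (range (zero_section : M -> E)) n (atlas c).
Proof.
split=> [e|p cp]; first exact: atlas_compatible.
split=> [[q _ <-] i ni|H].
  rewrite -[atlas c _]/(bundle_map c.1 (q, 0)) bundle_map_zero.
  case: (split_ordP i) ni => j ->; first by rewrite /= leqNgt ltn_ord.
  by rewrite row_mxEr mxE.
exists (val (p : tot)).1 => //; apply: val_inj => /=.
move: cp H; rewrite -[chart_dom _ p]/(tot_dom c p) -[atlas c p]/(bundle_map c.1 (val (p : tot))).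
case: (p : tot) => -[q xi] /= gz cq H; congr (_, _); apply/esym.
have kq := ref_frame_dom q.
have xC : xi *m cocycle (ref_frame q) c.1 q = 0.
  apply/rowP => j; have := H (rshift n j) (leq_addr _ _).
  by rewrite row_mxEr => ->; rewrite mxE.
by rewrite -(mulmx1 xi) -(cocycle1 kq) -(cocycleM kq cq kq) mulmxA xC mul0mx.
Qed.

Lemma zero_section_tangent (c : atlas_index E) (p : E) v : chart_dom (atlas c) p ->
  rsubmx v = 0 -> tangent_space (range (zero_section : M -> E)) n c p v.
Proof.
move=> cp v0; exists (atlas c); split=> //; first exact: zero_section_slice.
move=> i ni; rewrite (@diff_transition _ _ E c c p v cp cp) (Jac1 cp) mulmx1.
case: (split_ordP i) ni => j ->; first by rewrite /= leqNgt ltn_ord.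
by move=> _; have := congr1 (fun A : 'rV[R]_r => A 0 j) v0; rewrite !mxE.
Qed.

(** A vector (v, xi) that omegat_s pairs to zero with all vectors tangent to the zero
    section is paired with (xi, 0): since xi is characteristic for M, what
    remains is g(xi, xi) = 0. *)
Lemma zero_section_coisotropic : (1 <= k)%N ->
  coisotropic (M := E) k (range (zero_section : M -> E)).
Proof.
move=> k1; split; first by rewrite k1 leqnn.
exists n; first split.
- exact: leq_addr.
- move=> _ [q _ <-]; exists (atlas ((ref_frame q, zero_section q) : atlas_index E)); split.
    exact: ref_frame_dom.
  exact: zero_section_slice.
move=> c _ [q _ <-] cq v [_ v2]; apply: (zero_section_tangent cq).
apply: (fr_metric_inj cq).
have Vr : char_distribution M (fr_chart c.1) q (rsubmx v *m fr_row c.1 q).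
  by apply/(fr_char _ cq); exact: submxMl.
have := v2 k0 (ltn_ord k0) (row_mx (rsubmx v *m fr_row c.1 q) 0).
rewrite (zero_section_omega _ _ _ cq) row_mxKl row_mxKr !mul0mx.
rewrite [X in _ - X]mxE subr0 ev2_skew; last first.
  by apply: form2_skew; exact: chart_imP cq.1.
rewrite Vr.2 oppr0 add0r; apply.
by apply: (zero_section_tangent cq); rewrite row_mxKr.
Qed.

End Thickening.

Theorem theorem8p10 (R : realType) (n k : nat) (k_ge1 : (1 <= k)%N)
    (M : k_precosymplectic R n k) (hM : standing_assumptions M) :
  exists (m : nat) (Mt : k_cosymplectic R m k) (f : M -> Mt),
    [/\ embedding f,
        forall i : 'I_k, is_pullback1 f (kpc_eta Mt i) (kpc_eta M i),
        forall j : 'I_k, is_pullback2 f (kpc_omega Mt j) (kpc_omega M j) &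
        coisotropic k (range f)].
Proof.
have [r Vr] := sa_char_distribution hM.
have [G [Gs GJ Gd]] := riemannian_metric M.
have /choice[ref_frame ref_frame_dom] := exists_frame Vr.
exists (n + r)%N, (tot_cosymplectic Gs GJ ref_frame_dom).
exists (zero_section Gs Gd ref_frame_dom (Ordinal k_ge1)).
split.
- exact: zero_section_embedding.
- exact: zero_section_pullback1.
- exact: zero_section_pullback2.
- exact: zero_section_coisotropic.
Qed.
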